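(* Under the setting described in the context (equal cluster sizes $n$, null log-linear model true with parameter $\boldsymbol{\theta}_0$), for any admissible function $\phi$, \[ \sqrt{N}\big(\widehat{\boldsymbol{p}}-\boldsymbol{p}(\widehat{\boldsymbol{\theta}}_{\phi})\big)\xrightarrow[N\to\infty]{\mathcal{L}}\mathcal{N}\Big(\boldsymbol{0}_M,\ \tfrac{\vartheta_n}{n}\big(\boldsymbol{\Sigma}_{\boldsymbol{p}(\boldsymbol{\theta}_0)}-\boldsymbol{\Sigma}_{\boldsymbol{p}(\boldsymbol{\theta}_0)}\boldsymbol{W}(\boldsymbol{W}^T\boldsymbol{\Sigma}_{\boldsymbol{p}(\boldsymbol{\theta}_0)}\boldsymbol{W})^{-1}\boldsymbol{W}^T\boldsymbol{\Sigma}_{\boldsymbol{p}(\boldsymbol{\theta}_0)}\big)\Big). \]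
   Context: Let $M\ge 3$ and $1\le M_0<M-1$. Let $\boldsymbol{W}$ be a real $M\times M_0$ matrix of full column rank whose columns, together with $\boldsymbol{1}_M=(1,\dots,1)^T$, are linearly independent. For $\boldsymbol{\theta}\in\mathbb{R}^{M_0}$ define the log-linear model $\boldsymbol{p}(\boldsymbol{\theta})=\exp\{\boldsymbol{W}\boldsymbol{\theta}\}/(\boldsymbol{1}_M^T\exp\{\boldsymbol{W}\boldsymbol{\theta}\})$ (componentwise exponential). For a probability vector $\boldsymbol{p}$, $\boldsymbol{D}_{\boldsymbol{p}}$ is the diagonal matrix with diagonal $\boldsymbol{p}$ and $\boldsymbol{\Sigma}_{\boldsymbol{p}}=\boldsymbol{D}_{\boldsymbol{p}}-\boldsymbol{p}\boldsymbol{p}^T$. Data (equal cluster sizes): $N$ clusters, each of size $n\ge 2$; the cluster frequency vectors $\boldsymbol{Y}^{(\ell)}=(Y^{(\ell)}_1,\dots,Y^{(\ell)}_M)^T$, $\ell=1,\dots,N$, are i.i.d. random vectors with nonnegative integer entries summing to $n$, with $\mathrm{E}[\boldsymbol{Y}^{(\ell)}]=n\boldsymbol{p}(\boldsymbol{\theta}_0)$ and $\mathrm{Var}[\boldsymbol{Y}^{(\ell)}]=\vartheta_n n\boldsymbol{\Sigma}_{\boldsymbol{p}(\boldsymbol{\theta}_0)}$, where $\vartheta_n=1+(n-1)\rho^2$ (design effect), $\rho^2\ge 0$ is the common intracluster correlation and $\boldsymbol{\theta}_0$ is the unknown true parameter. Let $\widehat{\boldsymbol{p}}^{(\ell)}=\boldsymbol{Y}^{(\ell)}/n$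 and $\widehat{\boldsymbol{p}}=\frac{1}{nN}\sum_{\ell=1}^N\boldsymbol{Y}^{(\ell)}$. An admissible $\phi:(0,\infty)\to\mathbb{R}$ is convex, twice continuously differentiable, with $\phi(1)=0$, $\phi'(1)=0$, $\phi''(1)>0$, and conventions $0\phi(0/0)=0$, $0\phi(p/0)=p\lim_{u\to\infty}\phi(u)/u$. The $\phi$-divergence is $d_\phi(\boldsymbol{p},\boldsymbol{q})=\sum_{r=1}^M q_r\phi(p_r/q_r)$. The quasi minimum $\phi$-divergence estimator (QM$\phi$E) is $\widehat{\boldsymbol{\theta}}_\phi=\arg\min_{\boldsymbol{\theta}}d_\phi(\widehat{\boldsymbol{p}},\boldsymbol{p}(\boldsymbol{\theta}))$ (assumed well defined). *)

(* Defs.v *)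
From HB Require Import structures.
From mathcomp Require Import all_boot all_order all_algebra.
From mathcomp Require Import all_classical all_reals all_analysis.
Set Implicit Arguments. Unset Strict Implicit. Unset Printing Implicit Defensive.
Import Order.TTheory GRing.Theory Num.Theory.
Import numFieldNormedType.Exports.
Local Open Scope classical_set_scope.
Local Open Scope ring_scope.

Section Defs.
Variable R : realType.

Definition pmod (M M0 : nat) (W : 'M[R]_(M, M0)) (theta : 'cV[R]_M0) : 'cV[R]_M :=
  \col_r (expR ((W *m theta) r 0) / \sum_(k < M) expR ((W *m theta) k 0)).

Definition Sigmap (M : nat) (p : 'cV[R]_M) : 'M[R]_M :=
  diag_mx (p^T) - p *m p^T.

Definition design_effect (n : nat) (rho2 : R) : R := 1 + (n.-1)%:R * rho2.

Definition admissible (phi : R -> R) : Prop :=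
  [/\ (forall x y t : R, 0 < x -> 0 < y -> 0 <= t <= 1 ->
          phi (t * x + (1 - t) * y) <= t * phi x + (1 - t) * phi y),
      (forall x : R, 0 < x -> derivable phi x 1),
      (forall x : R, 0 < x -> derivable (derive1 phi) x 1),
      (forall x : R, 0 < x -> {for x, continuous (derive1 (derive1 phi))}) &
      [/\ phi 1 = 0, derive1 phi 1 = 0 & 0 < derive1 (derive1 phi) 1]].

(* value of phi at u >= 0, with phi(0) := lim_{u -> 0+} phi(u) in [-oo,+oo] *)
Definition phiE (phi : R -> R) (u : R) : \bar R :=
  if 0 < u then (phi u)%:E else lim ((fun x => (phi x)%:E) @ 0^'+).

(* q_r phi(p_r/q_r) with the conventions 0 phi(0/0) = 0,
   0 phi(p/0) = p lim_{u->oo} phi(u)/u *)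
Definition phi_term (phi : R -> R) (pr qr : R) : \bar R :=
  if 0 < qr then (qr%:E * phiE phi (pr / qr))%E
  else if pr == 0 then 0%E
  else (pr%:E * lim ((fun u => (phi u / u)%:E) @ +oo%R))%E.

Definition dphi (phi : R -> R) (M : nat) (p q : 'cV[R]_M) : \bar R :=
  (\sum_(r < M) phi_term phi (p r ord0) (q r ord0))%E.

Definition phat (d : measure_display) (T : measurableType d) (M n : nat)
  (Y : nat -> T -> 'cV[nat]_M) (N : nat) (w : T) : 'cV[R]_M :=
  \col_r ((\sum_(l < N) (Y l w r 0)%:R) / (n * N)%:R).

(* mutual independence and identical distribution of a sequence of
   random vectors with values in a countable set: product rule for the
   joint point probabilities of any finite set of distinct indices *)
Definition iid_seq (d : measure_display) (T : measurableType d)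
  (P : probability T R) (M : nat) (Y : nat -> T -> 'cV[nat]_M) : Prop :=
  forall (s : seq nat) (ys : nat -> 'cV[nat]_M), uniq s ->
    P (\big[setI/setT]_(l <- s) [set w | Y l w = ys l]) =
    (\prod_(l <- s) P [set w | Y 0%N w = ys l])%E.

(* Z has the multivariate normal law N(0, S): characteristic function
   E[exp(i t^T Z)] = exp(-t^T S t / 2), written via real and imaginary parts *)
Definition is_normal0 (d : measure_display) (T : measurableType d)
  (Q : probability T R) (M : nat) (S : 'M[R]_M) (Z : T -> 'cV[R]_M) : Prop :=
  (forall i, measurable_fun setT (fun w => Z w i ord0)) /\
  forall t : 'cV[R]_M,
    ('E_Q[fun w => cos ((t^T *m Z w) ord0 ord0)])%E =
      (expR (- ((t^T *m S *m t) ord0 ord0) / 2))%:E /\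
    ('E_Q[fun w => sin ((t^T *m Z w) ord0 ord0)])%E = 0%E.

Definition cvg_law_normal0 (d : measure_display) (T : measurableType d)
  (P : probability T R) (M : nat) (X : nat -> T -> 'cV[R]_M) (S : 'M[R]_M) : Prop :=
  exists (d' : measure_display) (T' : measurableType d') (Q : probability T' R)
         (Z : T' -> 'cV[R]_M),
    is_normal0 Q S Z /\
    forall f : 'cV[R]_M -> R, continuous f -> (exists B : R, forall x, `|f x| <= B) ->
      ('E_P[fun w => f (X N w)])%E @[N --> \oo] --> ('E_Q[fun w => f (Z w)])%E.

End Defs.

(* Main.v *)
Require Import Defs.
From HB Require Import structures.
From mathcomp Require Import all_boot all_order all_algebra.
From mathcomp Require Import all_classical all_reals all_analysis.
From mathcomp Require Import measurable_realfun ring lra.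
Set Implicit Arguments. Unset Strict Implicit. Unset Printing Implicit Defensive.
Import Order.TTheory GRing.Theory Num.Theory.
Import numFieldNormedType.Exports.
Local Open Scope classical_set_scope.
Local Open Scope ring_scope.

(** Write [q] for [phat], [p0] for the true cell probabilities, [S] for
    [Sigmap p0] and [H] for [S W (W^T S W)^-1 W^T].

    Linearization.  Since [phi] is convex with [phi'' 1 > 0], the divergence
    [dphi q p] dominates a multiple of [|q - p|^2], and [dphi q p0] is
    [O(|q - p0|^2)]; hence the minimizing [p] satisfies [|q - p| = O(|q - p0|)].
    The first-order condition then reads [W^T (q - p) = o(|q - p0|)].  Because
    [log p - log p0] is [W (theta - theta0)] up to a constant vector,
    [p - p0 = H (p - p0) + O(|p - p0|^2)].  Together they give
    [q - p = (1 - H) (q - p0) + o(|q - p0|)], a statement about fixed vectors.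

    Limit law.  For a sum of [N] i.i.d. terms, the expectation of [f] is the
    [N]-th iterate of a one-step averaging operator applied to [f]; on cosines
    this iterate is, up to an error that tends to [0], multiplication by the
    Gaussian characteristic function, and on squares it gives the variance,
    hence tightness.  Characteristic functions determine the limit because a
    bounded continuous function is approximated on a box, without increasing
    its bound, by trigonometric polynomials (a Bernstein operator in the
    variables [sin (x i / 2 L)]).  The limiting Gaussian vector is a linear
    image of independent standard normal variables, and its covariance comes
    from [(1 - H) S (1 - H)^T = S - H S]. *)

(** Convergence of the estimator itself is neither shown nor used: all estimates concern the vector
    [pmod W theta], which the divergence controls directly. The linearization holds for every [q]
    summing to 1 within a fixed radius of [p0], uniformly over all minimizers, so randomness enters
    through [N |q - p0|^2] alone. That quantity has a majorant of constant mean, and the same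
    majorant pays, by Markov's inequality, for the event that [q] leaves the radius; this replaces a
    calculus of stochastic orders.

    The obstacle in the limit law is that independence is given as a product rule for point
    probabilities. A cluster has finitely many values, so one splits on the value of one cluster at
    a time, and this turns expectations into iterates of an operator. The approximants of [f] must
    respect its bound because outside the box they are compared with [f] through that bound, times a
    small probability. Cosines carry an arbitrary phase throughout, so that sines need no separate
    treatment. *)

Section bounded_expectation.
Context (d : measure_display) (T : measurableType d) (R : realType).
Variable P : probability T R.
Implicit Types f g : T -> R.

(** Every random variable whose expectation is taken is a function of finitely many bounded counts,
    or bounded outright like a cosine; boundedness then yields integrability at once. *)
Definition bmfun f := measurable_fun setT f /\ exists B : R, forall x, `|f x| <= B.

(** Real-valued so that ordinary arithmetic applies; meant for [bmfun] arguments, where the extended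
    expectation is finite. *)
Definition Ex f : R := fine ('E_P[f])%E.

Lemma bmfun_integrable f : bmfun f -> P.-integrable setT (EFin \o f).
Proof.
move=> [mf [B fB]]; apply: measurable_bounded_integrable => //.
  by rewrite -ge0_fin_numE ?fin_num_measure.
exists B; split; first exact: num_real.
by move=> r Br x _ /=; apply: le_trans (fB x) (ltW Br).
Qed.

Lemma ExE f : Ex f = \int[P]_x f x.
Proof. by rewrite /Ex unlock. Qed.

Lemma EFin_Ex f : bmfun f -> ('E_P[f])%E = (Ex f)%:E.
Proof.
move=> bf; rewrite /Ex fineK// unlock; apply: integrable_fin_num => //.
exact: bmfun_integrable.
Qed.

Lemma bmfun_cst r : bmfun (fun=> r).
Proof. by split=> //; exists `|r|. Qed.

Lemma bmfunD f g : bmfun f -> bmfun g -> bmfun (fun x => f x + g x).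
Proof.
move=> [mf [A fA]] [mg [B gB]]; split; first exact: measurable_funD.
by exists (A + B) => x; apply: le_trans (ler_normD _ _) _; exact: lerD.
Qed.

Lemma bmfunM f g : bmfun f -> bmfun g -> bmfun (fun x => f x * g x).
Proof.
move=> [mf [A fA]] [mg [B gB]]; split; first exact: measurable_funM.
by exists (A * B) => x; rewrite normrM ler_pM.
Qed.

Lemma bmfunZ k f : bmfun f -> bmfun (fun x => k * f x).
Proof. by move=> bf; apply: bmfunM => //; exact: bmfun_cst. Qed.

Lemma bmfunN f : bmfun f -> bmfun (fun x => - f x).
Proof.
move=> [mf [A fA]]; split; first exact: measurableT_comp.
by exists A => x; rewrite normrN.
Qed.

Lemma bmfunB f g : bmfun f -> bmfun g -> bmfun (fun x => f x - g x).
Proof. by move=> bf bg; apply: bmfunD => //; exact: bmfunN. Qed.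

Lemma bmfun_indic A : measurable A -> bmfun (\1_A : T -> R).
Proof.
move=> mA; split; first exact: measurable_indic.
exists 1 => x; rewrite indicE; case: (_ \in _) => /=; by rewrite ?normr1 ?normr0.
Qed.

Lemma bmfun_sum I (s : seq I) (F : I -> T -> R) :
  (forall i, bmfun (F i)) -> bmfun (fun x => \sum_(i <- s) F i x).
Proof.
move=> bF; elim: s => [|i s IH].
  by under eq_fun do rewrite big_nil; exact: bmfun_cst.
by under eq_fun do rewrite big_cons; exact: bmfunD.
Qed.

Lemma Ex_cst r : Ex (fun=> r) = r.
Proof. by rewrite /Ex [('E_P[_])%E]expectation_cst. Qed.

Lemma ExD f g : bmfun f -> bmfun g -> Ex (fun x => f x + g x) = Ex f + Ex g.
Proof. by move=> bf bg; rewrite !ExE RintegralD//; exact: bmfun_integrable. Qed.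

Lemma ExZ k f : bmfun f -> Ex (fun x => k * f x) = k * Ex f.
Proof. by move=> bf; rewrite !ExE RintegralZl//; exact: bmfun_integrable. Qed.

Lemma ExB f g : bmfun f -> bmfun g -> Ex (fun x => f x - g x) = Ex f - Ex g.
Proof. by move=> bf bg; rewrite !ExE RintegralB//; exact: bmfun_integrable. Qed.

Lemma Ex_sum I (s : seq I) (F : I -> T -> R) :
  (forall i, bmfun (F i)) -> Ex (fun x => \sum_(i <- s) F i x) = \sum_(i <- s) Ex (F i).
Proof.
move=> bF; elim: s => [|i s IH].
  by rewrite big_nil; under eq_fun do rewrite big_nil; rewrite Ex_cst.
rewrite big_cons; under eq_fun do rewrite big_cons.
by rewrite ExD ?IH//; exact: bmfun_sum.
Qed.

Lemma Ex_le f g : bmfun f -> bmfun g -> (forall x, f x <= g x) -> Ex f <= Ex g.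
Proof. by move=> bf bg fg; rewrite !ExE le_Rintegral//; exact: bmfun_integrable. Qed.

Lemma Ex_norm_le f g : bmfun f -> bmfun g -> (forall x, `|f x| <= g x) ->
  `|Ex f| <= Ex g.
Proof.
move=> bf bg fg; rewrite ler_norml; apply/andP; split.
  rewrite -mulN1r -ExZ//; apply: Ex_le => //; first exact: bmfunZ.
  by move=> x; have := fg x; rewrite ler_norml mulN1r => /andP[].
by apply: Ex_le => // x; have := fg x; rewrite ler_norml => /andP[].
Qed.

Lemma Ex_dist_le f g h : bmfun f -> bmfun g -> bmfun h ->
  (forall x, `|f x - g x| <= h x) -> `|Ex f - Ex g| <= Ex h.
Proof. by move=> bf bg bh fgh; rewrite -ExB//; apply: Ex_norm_le => //; exact: bmfunB. Qed.

Lemma Ex_indic A : measurable A -> Ex (\1_A : T -> R) = fine (P A).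
Proof. by move=> mA; rewrite /Ex expectation_indic. Qed.

End bounded_expectation.

(** * Taylor bounds for sine, cosine and the exponential *)

Section trigonometric_bounds.
Variable R : realType.
Implicit Types x y : R.

(** Covers both signs of [x]. The information [|c| <= |x|] lets each bound below follow from the
    previous one, applied to the derivative; the constants are not sharp. *)
Lemma MVT0 (f df : R -> R) x : (forall y, is_derive y 1 f (df y)) ->
  exists2 c, `|c| <= `|x| & f x - f 0 = df c * x.
Proof.
move=> fdf.
have cf : continuous f.
  by move=> y; apply: differentiable_continuous; apply/derivable1_diffP; have [] := fdf y.
have [x0|x0] := leP 0 x.
  have [c cx fE] : exists2 c, c \in `[0, x] & f x - f 0 = df c * (x - 0).
    by apply: MVT_segment => //; exact: continuous_subspaceT.
  exists c; last by rewrite fE subr0.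
  by move: cx; rewrite in_itv/= => /andP[c0 cx]; rewrite !ger0_norm.
have [c cx fE] : exists2 c, c \in `[x, 0] & f 0 - f x = df c * (0 - x).
  by apply: MVT_segment => //; [exact: ltW|exact: continuous_subspaceT].
exists c; last by rewrite -opprB fE; ring.
move: cx; rewrite in_itv/= => /andP[xc c0].
by rewrite (ler0_norm c0) (ler0_norm (ltW x0)) lerN2.
Qed.

Lemma norm_sin_le x : `|sin x| <= `|x|.
Proof.
have [c _] := MVT0 x (fun y => @is_derive_sin R y).
rewrite sin0 subr0 => ->; rewrite normrM ler_piMl// ler_norml.
by rewrite cos_geN1 cos_le1.
Qed.

Lemma norm_cosB1_le x : `|cos x - 1| <= x ^+ 2.
Proof.
have [c cx] := MVT0 x (fun y => @is_derive_cos R y).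
rewrite cos0 => ->; rewrite normrM normrN -real_normK ?num_real// expr2.
by rewrite ler_wpM2r//; exact: le_trans (norm_sin_le c) cx.
Qed.

Lemma norm_sinB_le x : `|sin x - x| <= `|x| ^+ 3.
Proof.
have D y : is_derive y 1 (fun z : R => sin z - z) (cos y - 1).
  by apply: is_deriveB.
have [c cx] := MVT0 x D; rewrite sin0 !subr0 => ->.
rewrite normrM exprSr ler_wpM2r//; apply: le_trans (norm_cosB1_le c) _.
by rewrite -real_normK ?num_real// lerXn2r ?nnegrE.
Qed.

Lemma norm_cosB_le x : `|cos x - (1 - x ^+ 2 / 2)| <= x ^+ 4.
Proof.
have D y : is_derive y 1 (fun z : R => cos z - (1 - z ^+ 2 / 2)) (y - sin y).
  by apply: is_derive_eq; rewrite /GRing.scale/=; field.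
have [c cx] := MVT0 x D; rewrite cos0 expr0n/= mul0r !subr0 subrr subr0 => ->.
rewrite normrM distrC -[leRHS]ger0_norm ?exprn_even_ge0// normrX exprSr ler_wpM2r//.
by apply: le_trans (norm_sinB_le c) _; rewrite lerXn2r ?nnegrE.
Qed.

(** The exponential lies between [1 - y] and [1 / (1 + y)], and the latter is at most [1 - y + y^2]
    because [(1 + y) (1 - y + y^2) = 1 + y^3]. *)
Lemma norm_expRNB_le y : 0 <= y -> `|expR (- y) - (1 - y)| <= y ^+ 2.
Proof.
move=> y0.
rewrite ger0_norm; last by rewrite subr_ge0 expR_ge1Dx.
have E := expR_ge1Dx y.
have y1 : 0 < 1 + y by lra.
have : expR (- y) <= (1 + y)^-1 by rewrite expRN lef_pV2 ?posrE ?expR_gt0.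
move=> /le_trans F; rewrite lerBlDr; apply: F.
rewrite -[_^-1]mul1r ler_pdivrMr//.
have : 0 <= y ^+ 3 by exact: exprn_ge0.
by lra.
Qed.

End trigonometric_bounds.

(** * Trigonometric approximation *)

Section independent_sampling.
Variables (R : realType) (I : finType) (g : I -> bool -> R).
Hypothesis g1 : forall i, \sum_b g i b = 1.

Lemma sum_prod_weights : \sum_(e : {ffun I -> bool}) \prod_i g i (e i) = 1.
Proof. by rewrite -bigA_distr_bigA big1. Qed.

(** Additivity of variance for independent centred variables: a sum over configurations of a product
    factors over the coordinates, and in a cross term the factor at [i] is the mean of [a i]. *)
Lemma second_moment_sampling (a : I -> bool -> R) (S : pred I) :
  (forall i, \sum_b g i b * a i b = 0) ->
  \sum_(e : {ffun I -> bool}) (\prod_i g i (e i)) * (\sum_(i | S i) a i (e i)) ^+ 2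
  = \sum_(i | S i) \sum_b g i b * a i b ^+ 2.
Proof.
move=> a0.
(* The factor of coordinate [j] in the weight times [a i * a k]; both conditionals fire at once when
   [i = k], which produces the square. *)
pose h i k j b := g j b * (if j == i then a i b else 1) * (if j == k then a k b else 1).
have hE i k (e : {ffun I -> bool}) :
    (\prod_j g j (e j)) * (a i (e i) * a k (e k)) = \prod_j h i k j (e j).
  rewrite /h !big_split/= -mulrA; congr (_ * (_ * _)).
    by rewrite (bigD1 i)//= eqxx big1 ?mulr1// => j /negbTE ->.
  by rewrite (bigD1 k)//= eqxx big1 ?mulr1// => j /negbTE ->.
have hs i k : \sum_(e : {ffun I -> bool}) (\prod_j g j (e j)) * (a i (e i) * a k (e k))
    = if i == k then \sum_b g i b * a i b ^+ 2 else 0.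
  under eq_bigr do rewrite hE.
  rewrite -bigA_distr_bigA; have [<-|ik] := eqVneq i k.
    rewrite (bigD1 i)//= [X in _ * X]big1 => [|j /negbTE ji].
      by rewrite mulr1 /h eqxx; under eq_bigr do rewrite -mulrA -expr2.
    by rewrite /h ji; under eq_bigr do rewrite !mulr1.
  rewrite (bigD1 i)//= /h eqxx (negbTE ik).
  by under eq_bigr do rewrite mulr1; rewrite a0 mul0r.
transitivity (\sum_(i | S i) \sum_(k | S k) \sum_(e : {ffun I -> bool})
    (\prod_j g j (e j)) * (a i (e i) * a k (e k))).
  rewrite (eq_bigr (fun i => \sum_(e : {ffun I -> bool}) \sum_(k | S k)
    (\prod_j g j (e j)) * (a i (e i) * a k (e k)))); last first.
    by move=> i _; rewrite exchange_big.
  rewrite exchange_big/=; apply: eq_bigr => e _.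
  rewrite expr2 mulr_suml mulr_sumr; apply: eq_bigr => i _.
  by rewrite mulr_sumr mulr_sumr.
apply: eq_bigr => i Si; rewrite (bigD1 i)//= hs eqxx [X in _ + X]big1 ?addr0// => k /andP[_ ki].
by rewrite hs eq_sym (negbTE ki).
Qed.

End independent_sampling.

Section sine_chart.
Variable R : realType.
Implicit Types x y s : R.

(** On [-1/2, 1/2] the slope of sine is at least [1 - c^2 >= 3/4], so sine is a chart there with
    Lipschitz inverse. *)
Lemma sin_lipschitz_below x y : `|x| <= 2^-1 -> `|y| <= 2^-1 ->
  3 / 4 * `|x - y| <= `|sin x - sin y|.
Proof.
wlog xy : x y / x <= y => [H hx hy|].
  case: (leP x y) => [xy|/ltW yx]; first exact: H.
  by rewrite distrC (distrC (sin x)); exact: H.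
move=> hx hy.
have [c cxy ->] : exists2 c, c \in `[x, y] & sin x - sin y = cos c * (x - y).
  have [|c cxy E] := @MVT_segment R sin cos x y xy (fun z _ => is_derive_sin z).
    by apply: continuous_subspaceT => z; exact: continuous_sin.
  by exists c => //; rewrite -opprB E; ring.
have c2 : `|c| <= 2^-1.
  move: cxy hx hy; rewrite in_itv/= !ler_norml => /andP[xc cy] /andP[? ?] /andP[? ?].
  by apply/andP; split; lra.
rewrite normrM ler_wpM2r//; apply: le_trans (ler_norm _).
have := norm_cosB1_le c; rewrite ler_norml => /andP[+ _].
have : c ^+ 2 <= 4^-1.
  rewrite -real_normK ?num_real//.
  have -> : 4^-1 = 2^-1 ^+ 2 :> R by field.
  by rewrite lerXn2r ?nnegrE.
by lra.
Qed.

Lemma sin_mono_half x y : `|x| <= 2^-1 -> `|y| <= 2^-1 -> x <= y -> sin x <= sin y.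
Proof.
move=> hx hy; rewrite le_eqVlt => /predU1P[->//|xy].
have [|c cxy E] := @MVT R sin cos x y xy (fun z _ => is_derive_sin z).
  by apply: continuous_subspaceT => z; exact: continuous_sin.
rewrite -subr_ge0 E mulr_ge0 ?subr_ge0 ?(ltW xy)//.
have := norm_cosB1_le c; rewrite ler_norml => /andP[+ _].
have : c ^+ 2 <= 1.
  rewrite -real_normK ?num_real// -[leRHS](expr1n _ 2) lerXn2r ?nnegrE//.
  move: cxy hx hy; rewrite in_itv/= !ler_norml => /andP[xc cy] /andP[? ?] /andP[? ?].
  by apply/andP; split; lra.
by lra.
Qed.

(** Bernstein frequencies give values [s] in [-1, 1], which may fall outside the range of sine on
    the chart. Clamping [s] to that range never increases its distance to a value attained there. *)
Lemma sin_projection s : exists2 x, `|x| <= 2^-1 &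
  forall y, `|y| <= 2^-1 -> `|sin x - sin y| <= `|s - sin y|.
Proof.
have h : `|2^-1 : R| <= 2^-1 by rewrite ger0_norm.
have hN : `|- 2^-1 : R| <= 2^-1 by rewrite normrN.
have [s1|s1] := leP s (sin (- 2^-1)).
  exists (- 2^-1) => // y hy.
  have : sin (- 2^-1) <= sin y.
    by apply: sin_mono_half => //; move: hy; rewrite ler_norml => /andP[].
  by move=> H; rewrite !ler0_norm ?subr_le0//; lra.
have [s2|s2] := leP (sin 2^-1) s.
  exists 2^-1 => // y hy.
  have : sin y <= sin 2^-1.
    by apply: sin_mono_half => //; move: hy; rewrite ler_norml => /andP[].
  by move=> H; rewrite !ger0_norm ?subr_ge0//; lra.
have [|||x] := @IVT R sin (- 2^-1) 2^-1 s.
- by lra.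
- by apply: continuous_subspaceT => z; exact: continuous_sin.
- by rewrite min_l ?max_r ?ltW//; lra.
rewrite in_itv/= => hx <-; exists x => //; by rewrite ler_norml.
Qed.

End sine_chart.

Section trigonometric_polynomials.
Variables (R : realType) (M : nat).
Implicit Types (t x y : 'cV[R]_M) (f g : 'cV[R]_M -> R).

Lemma dotDl t s x :
  ((t + s)^T *m x) ord0 ord0 = (t^T *m x) ord0 ord0 + (s^T *m x) ord0 ord0.
Proof. by rewrite linearD mulmxDl mxE. Qed.

Lemma dotBl t s x :
  ((t - s)^T *m x) ord0 ord0 = (t^T *m x) ord0 ord0 - (s^T *m x) ord0 ord0.
Proof. by rewrite linearB mulmxBl !mxE. Qed.

(** The phase [th] makes a single generator cover sines and constants; induction then reduces
    convergence of expectations to single cosines. *)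
Inductive trigpoly : ('cV[R]_M -> R) -> Prop :=
| trigpoly_cos t th : trigpoly (fun x => cos ((t^T *m x) ord0 ord0 + th))
| trigpolyD f g : trigpoly f -> trigpoly g -> trigpoly (fun x => f x + g x)
| trigpolyZ k f : trigpoly f -> trigpoly (fun x => k * f x).

Lemma trigpoly_cst k : trigpoly (fun=> k).
Proof.
have -> : (fun=> k) = (fun x => k * cos (((0 : 'cV[R]_M)^T *m x) ord0 ord0 + 0)).
  by apply/funext => x; rewrite trmx0 mul0mx mxE addr0 cos0 mulr1.
exact/trigpolyZ/trigpoly_cos.
Qed.

Lemma trigpolyM f g : trigpoly f -> trigpoly g -> trigpoly (fun x => f x * g x).
Proof.
move=> Tf Tg; elim: Tf => [t th|f1 f2 _ IH1 _ IH2|k f1 _ IH].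
- elim: Tg => [s ph|g1 g2 _ IH1 _ IH2|k g1 _ IH].
  + have -> : (fun x => cos ((t^T *m x) ord0 ord0 + th) * cos ((s^T *m x) ord0 ord0 + ph))
        = (fun x => 2^-1 * (cos (((t + s)^T *m x) ord0 ord0 + (th + ph))
                            + cos (((t - s)^T *m x) ord0 ord0 + (th - ph)))).
      apply/funext => x; rewrite dotDl dotBl.
      set A := (t^T *m x) _ _; set B := (s^T *m x) _ _.
      rewrite (_ : A + B + (th + ph) = (A + th) + (B + ph)); last by ring.
      rewrite (_ : A - B + (th - ph) = (A + th) - (B + ph)); last by ring.
      by rewrite (cosB (A + th)) (cosD (A + th)); field.
    by apply: trigpolyZ; apply: trigpolyD; exact: trigpoly_cos.
  + by under eq_fun do rewrite mulrDr; exact: trigpolyD.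
  + by under eq_fun do rewrite mulrCA; exact: trigpolyZ.
- by under eq_fun do rewrite mulrDl; exact: trigpolyD.
- by under eq_fun do rewrite -mulrA; exact: trigpolyZ.
Qed.

Lemma trigpoly_sum (I : Type) (s : seq I) (F : I -> 'cV[R]_M -> R) :
  (forall i, trigpoly (F i)) -> trigpoly (fun x => \sum_(i <- s) F i x).
Proof.
move=> TF; elim: s => [|i s IH].
  by under eq_fun do rewrite big_nil; exact: trigpoly_cst.
by under eq_fun do rewrite big_cons; exact: trigpolyD.
Qed.

Lemma trigpoly_prod (I : Type) (s : seq I) (F : I -> 'cV[R]_M -> R) :
  (forall i, trigpoly (F i)) -> trigpoly (fun x => \prod_(i <- s) F i x).
Proof.
move=> TF; elim: s => [|i s IH].
  by under eq_fun do rewrite big_nil; exact: trigpoly_cst.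
by under eq_fun do rewrite big_cons; exact: trigpolyM.
Qed.

Lemma trigpoly_sin_coord i k : trigpoly (fun x => sin (k * x i ord0)).
Proof.
have -> : (fun x => sin (k * x i ord0))
    = (fun x => cos (((k *: delta_mx i ord0 : 'cV[R]_M)^T *m x) ord0 ord0 + - (pi / 2))).
  apply/funext => x; rewrite -[RHS]cosN opprD opprK cosDpihalf sinN opprK.
  congr sin; rewrite linearZ/= trmx_delta -scalemxAl -rowE.
  by rewrite !mxE.
exact: trigpoly_cos.
Qed.

End trigonometric_polynomials.

Section trigonometric_approximation.
Variables (R : realType) (M : nat).
Implicit Types (x y : 'cV[R]_M) (f g : 'cV[R]_M -> R).

(** If all coordinates are closer than a uniform radius [del], continuity gives [eps]; otherwise the
    trivial bound [2 B] is paid for by the quadratic term, with [C = 2 B / del^2]. Averaging later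
    turns that term into a variance. *)
Lemma box_unif_continuous f (L B eps : R) : continuous f ->
  (forall x, `|f x| <= B) -> 0 < eps ->
  exists2 C : R, 0 <= C & forall x y, (forall i, `|x i ord0| <= L) ->
    `|f x - f y| <= eps + C * \sum_i (x i ord0 - y i ord0) ^+ 2.
Proof.
move=> cf fB e0.
have B0 : 0 <= B := le_trans (normr_ge0 _) (fB 0).
pose K := [set v : 'rV[R]_M | forall i, `[- L, L]%classic (v ord0 i)].
have cK : compact K.
  by apply: (@rV_compact R M (fun=> `[- L, L]%classic)) => _; exact: segment_compact.
pose P (del : R) (x : 'rV[R]_M) := forall y, (forall i, `|x ord0 i - y i ord0| < del) ->
  `|f x^T - f y| < eps.
(* Compactness in near-covering form: the local radius, tending to 0 from the right, can be chosen
   uniformly over the box. *)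
have /compact_near_coveringP/(_ R (0^'+) P _) nearK := cK.
have nearP : \forall del \near 0^'+, K `<=` P del /\ 0 < del.
  apply: filterI; last exact: nbhs_right_gt.
  apply: nearK => x Kx.
  have /cvgrPdist_lt/(_ _ (divr_gt0 e0 (ltr0n R 2))) := cf x^T.
  move=> /nbhs_ballP[r /= r0 Hr].
  exists (ball x (r / 2), [set del | del < r / 2]) => /=.
    split; first by apply: nbhsx_ballx; rewrite divr_gt0.
    by apply: nbhs_right_lt; rewrite divr_gt0.
  move=> [x' del]/= [[_ xx'] dr] y x'y.
  have h1 : `|f x^T - f x'^T| < eps / 2.
    apply: Hr; split=> // i j; rewrite !mxE ord1.
    by apply: lt_trans (xx' ord0 i) _; rewrite ltr_pdivrMr// ltr_pMr// ltr1n.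
  have h2 : `|f x^T - f y| < eps / 2.
    apply: Hr; split=> // i j; rewrite !mxE ord1 /ball/=.
    rewrite -(subrKA (x' ord0 i)) (splitr r); apply: le_lt_trans (ler_normD _ _) _.
    by apply: ltrD; [exact: (xx' ord0 i)|apply: lt_trans (x'y i) dr].
  rewrite -(subrKA (f x^T)) (splitr eps); apply: le_lt_trans (ler_normD _ _) _.
  by apply: ltrD => //; rewrite distrC.
have [del [Hdel del0]] := @filter_ex _ _ (at_right_proper_filter (0 : R)) _ nearP.
exists (2 * B / del ^+ 2) => [|x y xL]; first by rewrite divr_ge0 ?sqr_ge0// mulr_ge0.
have S0 i : 0 <= (x i ord0 - y i ord0) ^+ 2 by exact: sqr_ge0.
have [H|/existsNP[i /negP]] := pselect (forall i, `|x i ord0 - y i ord0| < del).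
  apply: le_trans (_ : eps <= _); last first.
    by rewrite lerDl mulr_ge0 ?sumr_ge0// divr_ge0 ?sqr_ge0// mulr_ge0.
  have := Hdel x^T; rewrite /P trmxK => Hx; apply/ltW/Hx.
    by move=> i /=; rewrite mxE in_itv/= -ler_norml.
  by move=> i; rewrite mxE.
rewrite -leNgt => Hi.
apply: le_trans (ler_normB _ _) _; apply: le_trans (lerD (fB x) (fB y)) _.
apply: le_trans (_ : 2 * B / del ^+ 2 * del ^+ 2 <= _).
  by rewrite divfK ?gt_eqF ?exprn_gt0//; lra.
apply: le_trans (_ : 2 * B / del ^+ 2 * \sum_i (x i ord0 - y i ord0) ^+ 2 <= _); last first.
  by rewrite lerDr ltW.
have cf0 : 0 <= 2 * B / del ^+ 2 by rewrite divr_ge0 ?sqr_ge0// mulr_ge0.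
rewrite ler_wpM2l//.
rewrite (bigD1 i)//= ler_wpDr ?sumr_ge0// -[leRHS]real_normK ?num_real//.
by rewrite lerXn2r ?nnegrE// ltW.
Qed.

(* A multivariate Bernstein operator in the variables [(1 + sin (x i / 2L)) / 2]:
   being an average of values of [f], it stays within the bounds of [f]. *)
Lemma trigpoly_approx f (B L eps : R) : continuous f ->
  (forall x, `|f x| <= B) -> 0 < L -> 0 < eps ->
  exists2 g, trigpoly g & (forall x, `|g x| <= B) /\
    forall x, (forall i, `|x i ord0| <= L) -> `|f x - g x| <= eps.
Proof.
move=> cf fB L0 e0.
have [C C0 HC] := box_unif_continuous L cf fB (divr_gt0 e0 (ltr0n R 2)).
(* Division by [K] sends the box into [-1/2, 1/2], where sine is a chart. *)
pose K := 2 * L.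
have K0 : 0 < K by rewrite mulr_gt0.
have [s|xi Hxi] := @choice R R (fun s (x : R) => `|x| <= 2^-1 /\ forall y : R, `|y| <= 2^-1 ->
    `|sin x - sin y| <= `|s - sin y|).
  by have [x ? ?] := sin_projection s; exists x.
pose C' := C * K ^+ 2 * 8.
have C'0 : 0 <= C' by rewrite !mulr_ge0// ?ltW.
have [m0 Hm] : exists m : nat, C' * M%:R * 2 / eps < m%:R.
  by have /filter_ex[m] := @nbhs_infty_gtr R (C' * M%:R * 2 / eps); exists m.
pose m := m0.+1.
have m_gt0 : 0 < m%:R :> R by rewrite ltr0n.
pose v x i := (1 + sin (K^-1 * x i ord0)) / 2.
have v01 x i : 0 <= v x i <= 1.
  have := sin_geN1 (K^-1 * x i ord0); have := sin_le1 (K^-1 * x i ord0).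
  by rewrite /v => ? ?; apply/andP; split; lra.
(* Each coordinate [i] receives [m] independent coins of bias [v x i]; [u] below is the observed
   frequency, of variance [v (1 - v) / m]. *)
pose wt x (p : 'I_M * 'I_m) b := if b then v x p.1 else 1 - v x p.1.
have wt_ge0 x p b : 0 <= wt x p b.
  by have /andP[? ?] := v01 x p.1; rewrite /wt; case: b => //; lra.
have wt1 x p : \sum_b wt x p b = 1 by rewrite big_bool /wt/= addrCA subrr addr0.
pose W x (e : {ffun 'I_M * 'I_m -> bool}) := \prod_p wt x p (e p).
have W0 x e : 0 <= W x e by exact: prodr_ge0.
have W1 x : \sum_e W x e = 1 by apply: sum_prod_weights => p.
pose u (e : {ffun 'I_M * 'I_m -> bool}) i := \sum_(p | p.1 == i) (e p)%:R / m%:R : R.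
have row_sum i (F : 'I_M * 'I_m -> R) : \sum_(p | p.1 == i) F p = \sum_j F (i, j).
  rewrite (eq_bigr (fun p => F (p.1, p.2))); last by case.
  rewrite (eq_bigl (fun p : 'I_M * 'I_m => (p.1 == i) && xpredT p.2)); last first.
    by move=> p; rewrite andbT.
  by rewrite -(pair_big (fun k => k == i) xpredT (fun k j => F (k, j)))/= big_pred1_eq.
have U x i : \sum_e W x e * (u e i - v x i) ^+ 2 <= m%:R^-1.
  pose a (p : 'I_M * 'I_m) (b : bool) := (b%:R - v x p.1) / m%:R.
  rewrite (eq_bigr (fun e => W x e * (\sum_(p | p.1 == i) a p (e p)) ^+ 2)); last first.
    move=> e _; congr (_ * _ ^+ 2); rewrite /u /a !row_sum/=.
    under [in RHS]eq_bigr do rewrite mulrBl; rewrite sumrB; congr (_ - _).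
    by rewrite sumr_const card_ord -[RHS]mulr_natr divfK ?gt_eqF.
  rewrite second_moment_sampling; last 2 first.
  - exact: wt1.
  - by move=> p; rewrite big_bool /wt /a/= ; ring.
  rewrite row_sum.
  apply: le_trans (_ : \sum_(j < m) m%:R^-1 ^+ 2 <= _).
    apply: ler_sum => j _; rewrite big_bool /wt /a/=.
    have /andP[v0 v1] := v01 x i.
    rewrite [leLHS](_ : _ = v x i * (1 - v x i) * m%:R^-1 ^+ 2); last by ring.
    by rewrite ler_piMl ?sqr_ge0//; nra.
  by rewrite sumr_const card_ord -[leLHS]mulr_natr expr2 divfK ?gt_eqF.
(* The frequency is read as a sine [2 u - 1], clamped to the chart and scaled back to the box. The
   factor 8 below exceeds [(2 / (3/4))^2 = 64/9], from the slope 3/4 of the chart. *)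
pose node e : 'cV[R]_M := \col_i (K * xi (2 * u e i - 1)).
have nodeP x e i : (forall i, `|x i ord0| <= L) ->
    (x i ord0 - node e i ord0) ^+ 2 <= K ^+ 2 * 8 * (u e i - v x i) ^+ 2.
  move=> xL; rewrite mxE; set s := 2 * _ - 1.
  have xE : x i ord0 = K * (K^-1 * x i ord0) by rewrite mulVKf// gt_eqF.
  have yL : `|K^-1 * x i ord0| <= 2^-1.
    rewrite normrM gtr0_norm ?invr_gt0// mulrC ler_pdivrMr// /K mulrA mulVf ?mul1r//.
  have [xs1 xs2] := Hxi s; have h2 := xs2 _ yL; have h1 := sin_lipschitz_below xs1 yL.
  rewrite {1}xE -mulrBr exprMn -mulrA ler_pM2l ?exprn_gt0//.
  rewrite (_ : s - sin (K^-1 * x i ord0) = 2 * (u e i - v x i)) in h2; last by rewrite /s /v; field.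
  move: h1 h2; set y := K^-1 * _; set D := u e i - v x i; move=> h1 h2.
  have := le_trans h1 h2; rewrite normrM (ger0_norm (ler0n _ 2)) => h.
  rewrite -[leLHS]real_normK ?num_real// distrC -[in leRHS](@real_normK _ D) ?num_real//.
  have : 0 <= `|xi s - y| by []. have : 0 <= `|D| by [].
  move: h; clear; move: `|xi s - y| `|D| => p q; nra.
exists (fun x => \sum_e f (node e) * W x e).
  apply: trigpoly_sum => e; apply: trigpolyZ; apply: trigpoly_prod => p.
  have Tv : trigpoly (v ^~ p.1).
    rewrite /v; under eq_fun do rewrite mulrC.
    apply/trigpolyZ/trigpolyD; [exact: trigpoly_cst|exact: trigpoly_sin_coord].
  rewrite /wt; case: (e p) => //.
  apply: trigpolyD; first exact: trigpoly_cst.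
  by under eq_fun do rewrite -mulN1r; exact: trigpolyZ.
split=> [x|x xL].
  apply: le_trans (ler_norm_sum _ _ _) _.
  apply: le_trans (_ : \sum_e B * W x e <= _); last by rewrite -mulr_sumr W1 mulr1.
  by apply: ler_sum => e _; rewrite normrM (ger0_norm (W0 _ _)) ler_wpM2r.
have -> : f x - \sum_e f (node e) * W x e = \sum_e (f x - f (node e)) * W x e.
  under [RHS]eq_bigr do rewrite mulrBl.
  by rewrite sumrB -mulr_sumr W1 mulr1.
apply: le_trans (ler_norm_sum _ _ _) _.
apply: le_trans (_ : \sum_e (eps / 2 * W x e
    + C' * \sum_i W x e * (u e i - v x i) ^+ 2) <= _).
  apply: ler_sum => e _; rewrite normrM (ger0_norm (W0 _ _)).
  apply: le_trans (ler_wpM2r (W0 _ _) (HC x (node e) xL)) _.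
  rewrite mulrDl lerD2l -mulr_sumr [C' * _]mulrCA [leRHS]mulrC ler_wpM2r//.
  rewrite /C' -!mulrA ler_wpM2l// !mulrA mulr_sumr; apply: ler_sum => i _.
  by apply: le_trans (nodeP x e i xL) _; rewrite /K expr2 !mulrA.
rewrite big_split/= -!mulr_sumr W1 mulr1 [leRHS]splitr lerD2l exchange_big/=.
apply: le_trans (_ : C' * (M%:R / m%:R) <= _).
  rewrite ler_wpM2l//; apply: le_trans (ler_sum _ (fun i _ => U x i)) _.
  by rewrite sumr_const card_ord -[leLHS]mulr_natl.
rewrite mulrA ler_pdivrMr//.
have : C' * M%:R * 2 / eps < m%:R.
  by apply: lt_trans Hm _; rewrite ltr_nat.
by rewrite ltr_pdivrMr// => /ltW; lra.
Qed.

End trigonometric_approximation.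

(** * Convergence in law from convergence of cosines and tightness *)

Section levy_continuity.
Variables (R : realType) (M : nat).
Implicit Types (x : 'cV[R]_M) (f g : 'cV[R]_M -> R) (B L eps : R).

Definition outside (T : Type) (L : R) (X : T -> 'cV[R]_M) : set T :=
  [set w | exists i, L < `|X w i ord0|].

Section one_space.
Context (d : measure_display) (T : measurableType d).
Variable P : probability T R.
Variable X : T -> 'cV[R]_M.
Hypothesis mX : forall i, measurable_fun setT (fun w => X w i ord0).

Lemma measurable_outside L : measurable (outside L X).
Proof.
have -> : outside L X = \bigcup_(i in [set: 'I_M]) ((fun w => `|X w i ord0|) @^-1` `]L, +oo[).
  apply/seteqP; split=> [w [i Li]|w [i _]].
    by exists i => //=; rewrite in_itv/= andbT.
  by rewrite /= in_itv/= andbT; exists i.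
apply: fin_bigcup_measurable; first exact: finite_finset.
move=> i _; rewrite -[X in measurable X]setTI.
by apply: (measurableT_comp (@normr_measurable R setT) (mX i)).
Qed.

Lemma measurable_dot (t : 'cV[R]_M) : measurable_fun setT (fun w => (t^T *m X w) ord0 ord0).
Proof.
under eq_fun do rewrite mxE.
by apply: measurable_sum => i; apply: measurable_funM.
Qed.

Lemma bmfun_cos_dot (t : 'cV[R]_M) th : bmfun (fun w => cos ((t^T *m X w) ord0 ord0 + th)).
Proof.
split; last by exists 1 => w; rewrite ler_norml cos_geN1 cos_le1.
apply: measurableT_comp; first by apply: continuous_measurable_fun; exact: continuous_cos.
by apply: measurable_funD => //; exact: measurable_dot.
Qed.

Lemma bmfun_trigpoly g : trigpoly g -> bmfun (g \o X).
Proof.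
elim=> [t th|f1 f2 _ IH1 _ IH2|k f1 _ IH].
- exact: bmfun_cos_dot.
- exact: bmfunD.
- exact: bmfunZ.
Qed.

(** Measurability is obtained from that of the coordinates: [f] is the pointwise limit of
    trigonometric polynomials, the [k]-th one within [1 / (k + 1)] of [f] on the box of radius
    [k + 1]. *)
Lemma bmfun_continuous f B : continuous f -> (forall x, `|f x| <= B) -> bmfun (f \o X).
Proof.
move=> cf fB; split; last by exists B => w; exact: fB.
have [|g Hg] := @choice nat ('cV[R]_M -> R) (fun k g => trigpoly g /\
  forall x, (forall i, `|x i ord0| <= k.+1%:R) -> `|f x - g x| <= k.+1%:R^-1).
  move=> k; have [//||g Tg [_ Hg]] := @trigpoly_approx R M f B k.+1%:R k.+1%:R^-1 cf fB.
    by rewrite invr_gt0.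
  by exists g.
apply: (@measurable_fun_cvg _ _ _ setT (fun k => g k \o X)).
  by move=> k; have [Tg _] := Hg k; have [] := bmfun_trigpoly Tg.
move=> w _; apply/cvgrPdist_le => /= e e0.
near=> k; have [_ H] := Hg k; apply: le_trans (H _ _) _.
  move=> i; apply: le_trans (_ : \sum_j `|X w j ord0| <= _).
    by rewrite (bigD1 i)//= lerDl sumr_ge0.
  apply: le_trans (_ : k%:R <= _); last by rewrite ler_nat.
  by near: k; exact: nbhs_infty_ger.
by apply: ltW; near: k; exact: (near_infty_natSinv_lt (PosNum e0)).
Unshelve. all: by end_near. Qed.

(** Off the box the two functions are compared through their common bound, which must therefore not
    depend on the quality of the approximation. *)
Lemma Ex_approx_le f g B eps L : continuous f -> (forall x, `|f x| <= B) ->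
  trigpoly g -> (forall x, `|g x| <= B) ->
  (forall x, (forall i, `|x i ord0| <= L) -> `|f x - g x| <= eps) -> 0 <= eps ->
  `|Ex P (f \o X) - Ex P (g \o X)| <= eps + 2 * B * fine (P (outside L X)).
Proof.
move=> cf fB Tg gB fg e0.
have B0 : 0 <= B := le_trans (normr_ge0 _) (fB 0).
have mo := measurable_outside L.
have bo : bmfun (fun w => 2 * B * (\1_(outside L X) w : R)).
  by apply: bmfunZ; exact: bmfun_indic.
apply: le_trans (Ex_dist_le (h := fun w => eps + 2 * B * \1_(outside L X) w) P _ _ _ _) _.
- exact: bmfun_continuous cf fB.
- exact: bmfun_trigpoly.
- by apply: bmfunD => //; exact: bmfun_cst.
- move=> w /=; rewrite indicE; have [/set_mem wL|/negP wL] := boolP (w \in _).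
    rewrite mulr1; apply: le_trans (ler_normB _ _) _.
    by have := fB (X w); have := gB (X w); lra.
  rewrite mulr0 addr0; apply: fg => i; rewrite leNgt; apply/negP => Li.
  by apply: wL; rewrite inE; exists i.
- rewrite ExD ?Ex_cst//; last exact: bmfun_cst.
  by rewrite ExZ ?Ex_indic//; exact: bmfun_indic.
Qed.

(** Continuity from above: the sets [outside k X] decrease to the empty set. *)
Lemma tight1 eps : 0 < eps -> exists2 L, 0 < L & fine (P (outside L X)) <= eps.
Proof.
move=> e0.
have : P (outside k%:R X) @[k --> \oo] --> P (\bigcap_k outside k%:R X).
  apply: nonincreasing_cvg_mu => //.
  - by rewrite -ge0_fin_numE ?fin_num_measure//; exact: measurable_outside.
  - by move=> k; exact: measurable_outside.
  - by apply: bigcapT_measurable => k; exact: measurable_outside.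
  - move=> i j ij; apply/subsetPset => w [k kj]; exists k.
    by apply: le_lt_trans kj; rewrite ler_nat.
rewrite (_ : \bigcap_k _ = set0) ?measure0; last first.
  apply/seteqP; split=> // w /= H.
  have /filter_ex[k Hk] := @nbhs_infty_gtr R (\sum_j `|X w j ord0|).
  have [i Hi] := H k Logic.I; have := lt_trans Hk Hi.
  by rewrite (bigD1 i)//= ltNge lerDl sumr_ge0.
move=> /fine_cvgP[_] /cvgrPdist_le/(_ _ e0) H.
have [k [Hk k1]] : exists k, `|0 - fine (P (outside k%:R X))| <= eps /\ (0 < k)%N.
  near \oo => k; exists k; split; first by near: k.
  by near: k; exact: nbhs_infty_gt.
exists k%:R; first by rewrite ltr0n.
by move: Hk; rewrite sub0r normrN; apply: le_trans; exact: ler_norm.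
Unshelve. all: by end_near. Qed.

End one_space.

Lemma levy_continuity (d d' : measure_display) (T : measurableType d) (T' : measurableType d')
    (P : probability T R) (Q : probability T' R)
    (X : nat -> T -> 'cV[R]_M) (Z : T' -> 'cV[R]_M) :
  (forall N i, measurable_fun setT (fun w => X N w i ord0)) ->
  (forall i, measurable_fun setT (fun w => Z w i ord0)) ->
  (forall (t : 'cV[R]_M) th, Ex P (fun w => cos ((t^T *m X N w) ord0 ord0 + th)) @[N --> \oo] -->
     Ex Q (fun w => cos ((t^T *m Z w) ord0 ord0 + th))) ->
  (forall eps, 0 < eps ->
     exists L, \forall N \near \oo, fine (P (outside L (X N))) <= eps) ->
  forall f, continuous f -> (exists B : R, forall x, `|f x| <= B) ->
  ('E_P[fun w => f (X N w)])%E @[N --> \oo] --> ('E_Q[fun w => f (Z w)])%E.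
Proof.
move=> mX mZ cosXZ tightX f cf [B fB].
have B0 : 0 <= B := le_trans (normr_ge0 _) (fB 0).
rewrite (_ : (fun N => _) = (fun N => (Ex P (f \o X N))%:E)); last first.
  by apply/funext => N; apply: EFin_Ex; exact: (bmfun_continuous (mX N) cf fB).
rewrite EFin_Ex; last exact: (bmfun_continuous mZ cf fB).
apply: cvg_EFin; first exact: nearW.
have trigXZ g : trigpoly g -> Ex P (g \o X N) @[N --> \oo] --> Ex Q (g \o Z).
  elim=> [t th|f1 f2 T1 IH1 T2 IH2|k f1 T1 IH1].
  - exact: cosXZ.
  - rewrite ExD; [|exact: bmfun_trigpoly..].
    under eq_fun => N do rewrite (ExD P (bmfun_trigpoly (mX N) T1) (bmfun_trigpoly (mX N) T2)).
    exact: cvgD.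
  - rewrite ExZ; last exact: bmfun_trigpoly.
    under eq_fun => N do rewrite (ExZ P _ (bmfun_trigpoly (mX N) T1)).
    by apply: cvgM => //; exact: cvg_cst.
apply/cvgrPdist_le => e e0.
(* Passing from [f] to [g] costs at most [del + 2 B del] under each of the two laws, and the
   convergence of [g] costs one more [del]. *)
pose del := e / (4 * B + 3).
have den : 0 < 4 * B + 3 by lra.
have del0 : 0 < del by rewrite divr_gt0.
have [L1 HL1] := tightX _ del0.
have [L2 L20 HL2] := tight1 Q mZ del0.
pose L := Num.max L1 L2.
have L0 : 0 < L by rewrite lt_max L20 orbT.
have outS (U : Type) (V : U -> 'cV[R]_M) a b : a <= b -> outside b V `<=` outside a V.
  by move=> ab w [i bi]; exists i; exact: le_lt_trans bi.
have HZ : fine (Q (outside L Z)) <= del.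
  apply: le_trans HL2; rewrite fine_le ?fin_num_measure//; try exact: measurable_outside.
  apply: le_measure; rewrite ?inE; try exact: measurable_outside.
  by apply: outS; rewrite le_max lexx orbT.
have [g Tg [gB fg]] := trigpoly_approx cf fB L0 del0.
have /cvgrPdist_le/(_ _ del0) gXZ := trigXZ g Tg.
near=> N.
have HX : fine (P (outside L (X N))) <= del.
  apply: le_trans (_ : fine (P (outside L1 (X N))) <= _); last by near: N.
  rewrite fine_le ?fin_num_measure//; try exact: measurable_outside.
  apply: le_measure; rewrite ?inE; try exact: measurable_outside.
  by apply: outS; rewrite le_max lexx.
have h1 := Ex_approx_le P (mX N) cf fB Tg gB fg (ltW del0).
have h2 := Ex_approx_le Q mZ cf fB Tg gB fg (ltW del0).
have h3 : `|Ex Q (g \o Z) - Ex P (g \o X N)| <= del by near: N.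
have eE : e = del * (4 * B + 3) by rewrite /del divfK// gt_eqF.
have b1 : 2 * B * fine (P (outside L (X N))) <= 2 * B * del by rewrite ler_wpM2l// mulr_ge0.
have b2 : 2 * B * fine (Q (outside L Z)) <= 2 * B * del by rewrite ler_wpM2l// mulr_ge0.
change (`|Ex Q (f \o Z) - Ex P (f \o X N)| <= e).
rewrite eE; move: h1 h2 h3 b1 b2; rewrite !ler_norml.
move: (Ex P (f \o X N)) (Ex P (g \o X N)) (Ex Q (f \o Z)) (Ex Q (g \o Z)) => a1 a2 a3 a4.
move: (2 * B * fine _) (2 * B * fine _) => r1 r2.
move=> /andP[? ?] /andP[? ?] /andP[? ?] ? ?.
by apply/andP; split; lra.
Unshelve. all: by end_near. Qed.

End levy_continuity.

(** * Central limit theorem for sums of clusters *)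

Section iid_sums.
Variables (R : realType) (M n : nat) (d : measure_display) (T : measurableType d).
Variables (P : probability T R) (Y : nat -> T -> 'cV[nat]_M).
Hypothesis Ysum : forall l w, (\sum_(r < M) Y l w r ord0)%N = n.
Hypothesis mY : forall l (r : 'I_M), measurable_fun setT (fun w => (Y l w r ord0)%:R : R).
Hypothesis iidY : iid_seq P Y.

(** Counts summing to [n] lie between 0 and [n], so a cluster has a finite alphabet [V]. Any
    function of a cluster is then a finite combination of indicators of atoms, the very events on
    which independence is stated. *)
Let V := {ffun 'I_M -> 'I_n.+1}.
Let vec (v : V) : 'cV[nat]_M := \col_r (v r : nat).
Let code (y : 'cV[nat]_M) : V := [ffun r => inord (y r ord0)].

Let codeK l w : vec (code (Y l w)) = Y l w.
Proof.
apply/colP => r; rewrite !mxE ffunE inordK// ltnS -(Ysum l w).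
by rewrite (bigD1 r)//= leq_addr.
Qed.

Let vecK v : code (vec v) = v.
Proof. by apply/ffunP => r; rewrite ffunE mxE inord_val. Qed.

Lemma measurable_atom l y : measurable [set w | Y l w = y].
Proof.
have -> : [set w | Y l w = y] =
    \bigcap_(r in [set: 'I_M]) ((fun w => (Y l w r ord0)%:R : R) @^-1` [set (y r ord0)%:R]).
  apply/seteqP; split=> [w /= Yw r _ /=|w /= H]; first by rewrite Yw.
  apply/colP => r.
  by have /= /eqP := H r Logic.I; rewrite eqr_nat => /eqP.
apply: fin_bigcap_measurable; first exact: finite_finset.
by move=> r _; rewrite -[X in measurable X]setTI; exact: mY.
Qed.

Let atoms (h : 'cV[nat]_M -> R) l w :
  h (Y l w) = \sum_v h (vec v) * (\1_[set w | Y l w = vec v] w : R).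
Proof.
rewrite (bigD1 (code (Y l w)))//= codeK indicE mem_set// mulr1 big1 ?addr0// => v vY.
rewrite indicE memNset ?mulr0// => /= E.
by move: vY; rewrite E vecK eqxx.
Qed.

Lemma bmfun_cluster (h : 'cV[nat]_M -> R) l : bmfun (fun w => h (Y l w)).
Proof.
under eq_fun do rewrite atoms.
apply: bmfun_sum => v; apply: bmfunZ; apply: bmfun_indic; exact: measurable_atom.
Qed.

Let p (y : 'cV[nat]_M) : R := fine (P [set w | Y 0%N w = y]).

Let Ex_atoms h : Ex P (fun w => h (Y 0%N w)) = \sum_v h (vec v) * p (vec v).
Proof.
have mA v := measurable_atom 0 (vec v).
under eq_fun do rewrite atoms.
rewrite Ex_sum; last by move=> v; apply: bmfunZ; exact: bmfun_indic.
apply: eq_bigr => v _; rewrite ExZ; last exact: bmfun_indic.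
by rewrite Ex_indic.
Qed.

Let event s (ys : nat -> 'cV[nat]_M) : set T :=
  \big[setI/setT]_(l <- s) [set w | Y l w = ys l].

Let measurable_event s ys : measurable (event s ys).
Proof. by apply: bigsetI_measurable => l _; exact: measurable_atom. Qed.

Let fine_event s ys : uniq s -> fine (P (event s ys)) = \prod_(l <- s) p (ys l).
Proof.
move=> us; rewrite /event iidY// /p.
elim: s {us} => [|l s IH]; first by rewrite !big_nil.
rewrite !big_cons fineM ?IH//; first by rewrite fin_num_measure//; exact: measurable_atom.
by apply: prode_fin_num => k _; rewrite fin_num_measure//; exact: measurable_atom.
Qed.

Section sums.
Variable a : 'cV[nat]_M -> R.

Definition step (f : R -> R) (x : R) : R := Ex P (fun w => f (x + a (Y 0%N w))).

(** Sums of a fixed number of clusters stay in a bounded interval, so this gives integrability; it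
    admits squares as well as cosines. *)
Definition locally_bounded (f : R -> R) :=
  forall B : R, exists C : R, forall x, `|x| <= B -> `|f x| <= C.

Let bmfun_sum_cluster (f : R -> R) s x : measurable_fun setT f -> locally_bounded f ->
  bmfun (fun w => f (x + \sum_(l <- s) a (Y l w))).
Proof.
move=> mf bf.
have [mS [B SB]] : bmfun (fun w => x + \sum_(l <- s) a (Y l w)).
  apply: bmfunD; first exact: bmfun_cst.
  by apply: bmfun_sum => l; exact: bmfun_cluster.
split; first exact: measurableT_comp.
by have [C HC] := bf B; exists C => w; apply: HC.
Qed.

(** Generalized over an event prescribing the clusters in [r], so that the induction can move the
    head cluster from the sum to the event after splitting on its value. Distinctness of the indices
    makes that prescription compatible with the earlier ones. *)
Let iid_sum_event (f : R -> R) s r ys x : measurable_fun setT f -> locally_bounded f ->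
  uniq (s ++ r) ->
  Ex P (fun w => f (x + \sum_(l <- s) a (Y l w)) * \1_(event r ys) w)
  = iter (size s) step f x * \prod_(l <- r) p (ys l).
Proof.
move=> mf bf; elim: s r ys x => [|l s IH] r ys x /=.
  move=> ur; under eq_fun do rewrite big_nil addr0.
  rewrite ExZ; last exact: bmfun_indic.
  by rewrite Ex_indic// fine_event.
move=> /andP[lsr usr].
have lr : l \notin r by apply: contra lsr; rewrite mem_cat orbC => ->.
pose ys' v k := if k == l then vec v else ys k.
have evE v : event (l :: r) (ys' v) = [set w | Y l w = vec v] `&` event r ys.
  rewrite /event big_cons /ys' eqxx; congr (_ `&` _).
  apply: eq_big_seq => k kr; rewrite ifN//.
  by apply: contraNneq lr => <-.
transitivity (Ex P (fun w => \sum_v f ((x + a (vec v)) + \sum_(k <- s) a (Y k w))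
    * (\1_(event (l :: r) (ys' v)) w : R))).
  congr Ex; apply/funext => w; rewrite big_cons addrA.
  rewrite (atoms (fun y => f (x + a y + \sum_(k <- s) a (Y k w)))) mulr_suml.
  by apply: eq_bigr => v _; rewrite evE indicI/= mulrA.
rewrite Ex_sum; last first.
  move=> v; apply: bmfunM; first exact: bmfun_sum_cluster.
  by apply: bmfun_indic.
rewrite {1}/step (Ex_atoms (fun y => iter (size s) step f (x + a y))) mulr_suml.
apply: eq_bigr => v _; rewrite IH; last first.
  by rewrite uniq_catC/= mem_cat orbC -mem_cat lsr uniq_catC.
rewrite big_cons {1}/ys' eqxx mulrA; congr (_ * _).
apply: eq_big_seq => k kr; rewrite /ys' ifN//.
by apply: contraNneq lr => <-.
Qed.

Lemma Ex_iid_sum (f : R -> R) N : measurable_fun setT f -> locally_bounded f ->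
  Ex P (fun w => f (\sum_(l < N) a (Y l w))) = iter N step f 0.
Proof.
move=> mf bf.
have := @iid_sum_event f (iota 0 N) [::] (fun=> 0) 0 mf bf; rewrite cats0 iota_uniq.
rewrite /event !big_nil size_iota mulr1 => <-//; congr Ex; apply/funext => w.
by rewrite indicT mulr1 add0r -(big_mkord xpredT (fun l => a (Y l w))) /index_iota subn0.
Qed.

Lemma Ex_iid_sqr N : Ex P (fun w => a (Y 0%N w)) = 0 ->
  Ex P (fun w => (\sum_(l < N) a (Y l w)) ^+ 2) = N%:R * Ex P (fun w => a (Y 0%N w) ^+ 2).
Proof.
move=> a0; rewrite (Ex_iid_sum (f := fun x => x ^+ 2)); last 2 first.
- by apply: measurable_funX.
- move=> B; exists (B ^+ 2) => x xB; rewrite normrX lerXn2r ?nnegrE//.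
  exact: le_trans xB.
set s2 := Ex _ _.
(* Since the mean is 0, one averaging step adds the variance [s2] to [x^2] and leaves constants
   alone. *)
suff H x : iter N step (fun x => x ^+ 2) x = x ^+ 2 + N%:R * s2.
  by rewrite H expr0n add0r.
elim: N x => [|N IH] x /=; first by rewrite mul0r addr0.
have b1 : bmfun (fun w => x * a (Y 0%N w) *+ 2) := bmfun_cluster (fun y => x * a y *+ 2) 0%N.
have b2 : bmfun (fun w => a (Y 0%N w) ^+ 2) := bmfun_cluster (fun y => a y ^+ 2) 0%N.
have b3 := bmfunD b2 (bmfun_cst T (N%:R * s2)).
transitivity (Ex P (fun w => x ^+ 2 + (x * a (Y 0%N w) *+ 2 + (a (Y 0%N w) ^+ 2 + N%:R * s2)))).
  by congr Ex; apply/funext => w; rewrite IH; ring.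
etransitivity; first exact: (ExD P (bmfun_cst T (x ^+ 2)) (bmfunD b1 b3)).
rewrite [X in _ + X](ExD P b1 b3) [X in _ + (_ + X)](ExD P b2 (bmfun_cst T (N%:R * s2))).
rewrite !Ex_cst; under eq_fun do rewrite -mulrnAl.
rewrite ExZ; last exact: (bmfun_cluster a).
by rewrite a0 -/s2 mulr0 add0r -natr1; ring.
Qed.

(** By the addition formula, [x |-> cos (x + th)] is an eigenfunction of [step] for the value [w] up
    to an error [e]. Averaging does not increase the supremum norm and [w <= 1], so the errors of
    the [N] steps add up at most. *)
Lemma Ex_iid_cos N th w e : 0 <= w <= 1 ->
  `|Ex P (fun u => cos (a (Y 0%N u))) - w| + `|Ex P (fun u => sin (a (Y 0%N u)))| <= e ->
  `|Ex P (fun u => cos ((\sum_(l < N) a (Y l u)) + th)) - w ^+ N * cos th| <= N%:R * e.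
Proof.
move=> /andP[w0 w1] He.
rewrite (Ex_iid_sum (f := fun x => cos (x + th))); last 2 first.
- apply: measurableT_comp; last exact: measurable_funD.
  by apply: continuous_measurable_fun; exact: continuous_cos.
- by move=> B; exists 1 => x _; rewrite ler_norml cos_geN1 cos_le1.
suff H x : `|iter N step (fun x => cos (x + th)) x - w ^+ N * cos (x + th)| <= N%:R * e.
  by have := H 0; rewrite add0r.
elim: N x => [|N IH] x /=; first by rewrite mul1r subrr normr0 mul0r.
set F := iter N _ _ in IH *.
have b1 := bmfun_cluster (fun y => F (x + a y)) 0%N.
have b2 := bmfun_cluster (fun y => cos (x + a y + th)) 0%N.
have b3 := bmfun_cluster (fun y => cos (a y)) 0%N.
have b4 := bmfun_cluster (fun y => sin (a y)) 0%N.
have h1 : `|step F x - w ^+ N * Ex P (fun u => cos (x + a (Y 0%N u) + th))| <= N%:R * e.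
  rewrite -ExZ// /step -(Ex_cst P (N%:R * e)).
  by apply: Ex_dist_le => //; [exact: bmfunZ|exact: bmfun_cst].
have h2 : `|Ex P (fun u => cos (x + a (Y 0%N u) + th)) - w * cos (x + th)| <= e.
  have -> : Ex P (fun u => cos (x + a (Y 0%N u) + th))
      = cos (x + th) * Ex P (fun u => cos (a (Y 0%N u)))
        - sin (x + th) * Ex P (fun u => sin (a (Y 0%N u))).
    rewrite -!ExZ// -ExB; [|exact: bmfunZ..].
    congr Ex; apply/funext => u.
    by rewrite (addrAC x) (cosD (x + th)).
  set c := Ex _ _; set s := Ex _ _.
  rewrite (_ : _ - _ = cos (x + th) * (c - w) - sin (x + th) * s); last by ring.
  apply: le_trans He; apply: le_trans (ler_normB _ _) _.
  rewrite !normrM; apply: lerD; rewrite ler_piMl// ler_norml.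
    by rewrite cos_geN1 cos_le1.
  by rewrite sin_geN1 sin_le1.
rewrite exprSr -natr1 mulrDl mul1r.
rewrite -(subrKA (w ^+ N * Ex P (fun u => cos (x + a (Y 0%N u) + th)))).
apply: le_trans (ler_normD _ _) _; apply: lerD => //.
rewrite -mulrA -mulrBr normrM; apply: le_trans h2; rewrite ler_piMl//.
by rewrite ger0_norm ?exprn_ge0// exprn_ile1.
Qed.

End sums.

(** The eigenvalue is taken to be [w = exp (- s2 / (2 N))], whose [N]-th power is exactly the
    Gaussian factor. One step errs by at most [K N^(-3/2)], hence [N] steps by [K / sqrt N]. *)
Lemma clt_cos (a : 'cV[nat]_M -> R) th : Ex P (fun w => a (Y 0%N w)) = 0 ->
  Ex P (fun w => cos (\sum_(l < N) a (Y l w) / Num.sqrt N%:R + th)) @[N --> \oo] -->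
  expR (- Ex P (fun w => a (Y 0%N w) ^+ 2) / 2) * cos th.
Proof.
move=> a0; set s2 := Ex P _.
have [_ [A aA]] := bmfun_cluster a 0%N.
have A0 : 0 <= A by apply: le_trans (aA point).
have s20 : 0 <= s2.
  rewrite -(Ex_cst P 0); apply: Ex_le => [||w]; last exact: sqr_ge0.
    exact: bmfun_cst.
  exact: (bmfun_cluster (fun y => a y ^+ 2)).
(* The terms come from the remainders of cosine, of sine (whose linear part has mean 0) and of the
   exponential; fourth powers of [qi] are lowered to cubes because [qi <= 1]. *)
pose K := A ^+ 4 + A ^+ 3 + s2 ^+ 2.
have key N : (0 < N)%N ->
    `|Ex P (fun w => cos (\sum_(l < N) a (Y l w) / Num.sqrt N%:R + th))
      - expR (- s2 / 2) * cos th| <= K / Num.sqrt N%:R.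
  move=> N0; pose q : R := Num.sqrt N%:R.
  have N0' : 0 < N%:R :> R by rewrite ltr0n.
  have q0 : 0 < q by rewrite sqrtr_gt0.
  have q2 : q ^+ 2 = N%:R by rewrite sqr_sqrtr// ltW.
  have q1 : 1 <= q by rewrite -sqrtr1 ler_wsqrtr// ler1n.
  pose qi := q^-1.
  have qi0 : 0 < qi by rewrite invr_gt0.
  have qi1 : qi <= 1 by rewrite invf_le1.
  have Nq : N%:R * qi ^+ 2 = 1 by rewrite -q2 -exprMn divff ?expr1n// gt_eqF.
  pose b y := a y * qi.
  have bA w : `|b (Y 0%N w)| <= A * qi by rewrite normrM (gtr0_norm qi0) ler_pM2r.
  have Eb1 : Ex P (fun w => b (Y 0%N w)) = 0.
    under eq_fun do rewrite /b mulrC.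
    by rewrite ExZ ?a0 ?mulr0//; exact: bmfun_cluster.
  have Eb2 : Ex P (fun w => b (Y 0%N w) ^+ 2) = s2 * qi ^+ 2.
    have ba : bmfun (fun w => a (Y 0%N w) ^+ 2) := bmfun_cluster (fun y => a y ^+ 2) 0%N.
    rewrite mulrC -(ExZ P _ ba); congr Ex; apply/funext => w.
    by rewrite /b exprMn mulrC.
  have bb := bmfun_cluster (fun y => b y) 0%N.
  have bb2 : bmfun (fun w => b (Y 0%N w) ^+ 2) := bmfun_cluster (fun y => b y ^+ 2) 0%N.
  have bc := bmfun_cluster (fun y => cos (b y)) 0%N.
  have bs := bmfun_cluster (fun y => sin (b y)) 0%N.
  pose w := expR (- (s2 * qi ^+ 2 / 2)).
  have y0 : 0 <= s2 * qi ^+ 2 / 2 by rewrite divr_ge0// mulr_ge0// sqr_ge0.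
  have hc : `|Ex P (fun u => cos (b (Y 0%N u))) - (1 - s2 * qi ^+ 2 / 2)| <= (A * qi) ^+ 4.
    have b1 := bmfunB (bmfun_cst T 1) (bmfunZ 2^-1 bb2).
    have <- : Ex P (fun u => 1 - 2^-1 * b (Y 0%N u) ^+ 2) = 1 - s2 * qi ^+ 2 / 2.
      etransitivity; first exact: (ExB P (bmfun_cst T 1) (bmfunZ 2^-1 bb2)).
      by rewrite Ex_cst (ExZ P _ bb2) Eb2 [2^-1 * _]mulrC.
    rewrite -(Ex_cst P ((A * qi) ^+ 4)).
    apply: (Ex_dist_le P bc b1 (bmfun_cst T _)) => u /=.
    rewrite [2^-1 * _]mulrC; apply: le_trans (norm_cosB_le _) _.
    rewrite -[leLHS]ger0_norm ?exprn_even_ge0// normrX lerXn2r ?nnegrE//.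
    by rewrite mulr_ge0// ltW.
  have hs : `|Ex P (fun u => sin (b (Y 0%N u)))| <= (A * qi) ^+ 3.
    rewrite -[Ex P _]subr0 -Eb1 -(Ex_cst P ((A * qi) ^+ 3)).
    apply: (Ex_dist_le P bs bb (bmfun_cst T _)) => u /=; apply: le_trans (norm_sinB_le _) _.
    by rewrite lerXn2r ?nnegrE// mulr_ge0// ltW.
  have hw := norm_expRNB_le y0; rewrite -/w in hw.
  have He : `|Ex P (fun u => cos (b (Y 0%N u))) - w| + `|Ex P (fun u => sin (b (Y 0%N u)))|
      <= K * qi ^+ 3.
    have h1 : `|Ex P (fun u => cos (b (Y 0%N u))) - w|
        <= (A * qi) ^+ 4 + (s2 * qi ^+ 2 / 2) ^+ 2.
      rewrite -(subrKA (1 - s2 * qi ^+ 2 / 2)); apply: le_trans (ler_normD _ _) _.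
      by apply: lerD => //; rewrite distrC.
    apply: le_trans (lerD h1 hs) _.
    have q34 : qi ^+ 4 <= qi ^+ 3 by rewrite exprS ler_piMl// exprn_ge0// ltW.
    have q3 : 0 <= qi ^+ 3 by rewrite exprn_ge0// ltW.
    rewrite /K (exprMn 4 A qi) (exprMn 3 A qi) !mulrDl.
    rewrite (_ : (s2 * qi ^+ 2 / 2) ^+ 2 = s2 ^+ 2 * qi ^+ 4 / 4); last by field.
    have : A ^+ 4 * qi ^+ 4 <= A ^+ 4 * qi ^+ 3 by rewrite ler_wpM2l// exprn_ge0.
    have : s2 ^+ 2 * qi ^+ 4 <= s2 ^+ 2 * qi ^+ 3 by rewrite ler_wpM2l// sqr_ge0.
    have : 0 <= s2 ^+ 2 * qi ^+ 4 by rewrite mulr_ge0// ?sqr_ge0// exprn_ge0// ltW.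
    by lra.
  have w01 : 0 <= w <= 1.
    by rewrite expR_ge0/= -[leRHS]expR0 ler_expR oppr_le0.
  have := Ex_iid_cos N th w01 He.
  have -> : w ^+ N = expR (- s2 / 2).
    rewrite /w -expRM_natr; congr expR.
    rewrite [LHS](_ : _ = - s2 / 2 * (N%:R * qi ^+ 2)); last by field.
    by rewrite Nq mulr1.
  have -> : N%:R * (K * qi ^+ 3) = K / Num.sqrt N%:R.
    rewrite [LHS](_ : _ = K * qi * (N%:R * qi ^+ 2)); last by ring.
    by rewrite Nq mulr1.
  apply: le_trans; rewrite le_eqVlt; apply/orP; left; apply/eqP.
  by congr (`|Ex P _ - _|); apply/funext => u; rewrite /b -mulr_suml.
apply/cvgrPdist_le => e e0; near=> N.
have N0 : (0 < N)%N by near: N; exact: nbhs_infty_gt.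
rewrite distrC; apply: le_trans (key N N0) _.
have K0 : 0 <= K by rewrite !addr_ge0 ?exprn_ge0.
have sq0 : 0 < Num.sqrt N%:R :> R by rewrite sqrtr_gt0 ltr0n.
rewrite ler_pdivrMr// -ler_pdivrMl//.
apply: le_trans (_ : Num.sqrt ((e^-1 * K) ^+ 2) <= _).
  by rewrite sqrtr_sqr ler_norm.
apply: ler_wsqrtr; near: N; exact: nbhs_infty_ger.
Unshelve. all: by end_near. Qed.

End iid_sums.

(** * Gaussian vectors *)

Section standard_normal.
Variable R : realType.
Local Notation mu := (@lebesgue_measure R).
Let g (x : R) : R := normal_peak 1 * expR (- x ^+ 2 / 2).
Let Q : probability (measurableTypeR R) R := normal_prob (0 : R) 1.

Let gE : normal_pdf (0 : R) 1 = g.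
Proof.
rewrite normal_pdfE ?oner_eq0//; apply/funext => x.
by rewrite /normal_fun subr0 expr1n.
Qed.

Let peak0 : 0 <= normal_peak (1 : R). Proof. exact: normal_peak_ge0. Qed.

Let g_ge0 x : 0 <= g x. Proof. by rewrite mulr_ge0// expR_ge0. Qed.

Let g_le x : g x <= normal_peak 1.
Proof.
rewrite ler_piMr// -[leRHS]expR0 ler_expR mulNr oppr_le0.
by rewrite divr_ge0// sqr_ge0.
Qed.

Let is_derive_g (x : R) : is_derive x 1 g (- x * g x).
Proof.
by apply: is_derive_eq; rewrite /GRing.scale/= /g; field.
Qed.

Let continuous_derivable (f df : R -> R) : (forall x : R, is_derive x 1 f (df x)) -> continuous f.
Proof.
by move=> fdf y; apply: differentiable_continuous; apply/derivable1_diffP; have [] := fdf y.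
Qed.

Let continuous_g : continuous g. Proof. exact: continuous_derivable is_derive_g. Qed.

(** The Radon-Nikodym derivative of the normal law agrees almost everywhere with the explicit
    density [g], as both have the same integral over every measurable set. *)
Lemma integral_normal01 (f : R -> R) U : measurable U -> bmfun (f : measurableTypeR R -> R) ->
  (\int[Q]_(x in U) (f x)%:E = \int[mu]_(x in U) (f x * g x)%:E)%E.
Proof.
move=> mU bf; have [mf _] := bf.
have dom : Q `<< mu by exact: normal_prob_dominates.
have mg : measurable_fun U (EFin \o g).
  by apply/measurable_EFinP; apply: measurable_funTS; exact: continuous_measurable_fun.
have mfU : measurable_fun U (EFin \o f) by apply/measurable_EFinP; exact: measurable_funTS.
have fQ : Q.-integrable U (EFin \o f).
  by apply: (integrableS measurableT) => //; exact: (bmfun_integrable Q bf).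
rewrite -[LHS](Radon_Nikodym_change_of_variables dom)//=.
under [RHS]eq_integral do rewrite EFinM.
apply: ae_eq_integral => //.
- apply: emeasurable_funM => //; apply: (measurable_int mu).
  by apply: (integrableS measurableT) => //=; exact: Radon_Nikodym_integrable.
- exact: emeasurable_funM.
- apply: ae_eqe_mul2l => /=.
  rewrite Radon_NikodymE//=; case: cid => /= h [h1 h2 h3].
  apply: integral_ae_eq => //=.
  + exact: integrableS h2.
  + by move=> E _ mE; rewrite -h3//= /Q/= /normal_prob gE.
Qed.

Section truncated.
Variables (a th : R).
Hypothesis a0 : 0 < a.
(** The characteristic function cut off at [a]: on a compact segment one may differentiate under the
    integral and use the fundamental theorem of calculus, at the price of boundary terms of size
    [g a]. *)
Let F (t : R) : R := \int[mu]_(x in `[- a, a]) (cos (t * x + th) * g x).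

Let integrable_cont (f df : R -> R) : (forall x : R, is_derive x 1 f (df x)) ->
  mu.-integrable `[- a, a] (EFin \o f).
Proof.
move=> fdf; apply: continuous_compact_integrable; first exact: segment_compact.
by apply: continuous_subspaceT; exact: continuous_derivable fdf.
Qed.

Let is_derive_cosg (t x : R) : is_derive x 1 (fun x => cos (t * x + th) * g x)
  (- t * sin (t * x + th) * g x - x * cos (t * x + th) * g x).
Proof. by apply: is_derive_eq; rewrite /GRing.scale/= /g; field. Qed.

Let is_derive_sing (t x : R) : is_derive x 1 (fun x => sin (t * x + th) * g x)
  (t * cos (t * x + th) * g x - x * sin (t * x + th) * g x).
Proof. by apply: is_derive_eq; rewrite /GRing.scale/= /g; field. Qed.

Let is_derive_xsing (t x : R) : is_derive x 1 (fun x => - x * sin (t * x + th) * g x)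
  (- sin (t * x + th) * g x - x * t * cos (t * x + th) * g x + x ^+ 2 * sin (t * x + th) * g x).
Proof. by apply: is_derive_eq; rewrite /GRing.scale/= /g; field. Qed.

Let is_derive_param (x t : R) : is_derive t 1 (fun t => cos (t * x + th) * g x)
  (- x * sin (t * x + th) * g x).
Proof. by apply: is_derive_eq; rewrite /GRing.scale/= /g; field. Qed.

Let is_derive_F (t : R) : is_derive t 1 F
  (\int[mu]_(x in `[- a, a]) (- x * sin (t * x + th) * g x)).
Proof.
pose f (t x : R) := cos (t * x + th) * g x.
have d1 s y : partial1of2 f s y = - y * sin (s * y + th) * g y.
  by rewrite partial1of2E; have [_ ->] := is_derive_param y s.
have It : `]t - 1, t + 1[%classic t by rewrite /= in_itv/=; apply/andP; split; lra.
have intf s : `]t - 1, t + 1[%classic s -> mu.-integrable `[- a, a] (EFin \o f s).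
  by move=> _; exact: integrable_cont (is_derive_cosg s).
have der s y : `]t - 1, t + 1[%classic s -> `[- a, a]%classic y -> derivable (f ^~ y) s 1.
  by move=> _ _; have [] := is_derive_param y s.
have G0 (y : R) : 0 <= (fun=> a * normal_peak 1) y :> R by rewrite mulr_ge0// ltW.
have intG : mu.-integrable `[- a, a] (EFin \o (fun=> a * normal_peak 1)).
  apply: continuous_compact_integrable; first exact: segment_compact.
  by apply: continuous_subspaceT; exact: cst_continuous.
have ub s y : `]t - 1, t + 1[%classic s -> `[- a, a]%classic y ->
    `|partial1of2 f s y| <= a * normal_peak 1.
  move=> _; rewrite /= in_itv/= -ler_norml => ya; rewrite d1 (normrM _ (g y)) (normrM (- y)) normrN.
  rewrite (ger0_norm (g_ge0 y)); apply: ler_pM => //.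
  by apply: le_trans ya; rewrite ler_piMr// ler_norml sin_geN1 sin_le1.
have mB : measurable (`[- a, a]%classic : set (measurableTypeR R)) by exact: measurable_itv.
apply: DeriveDef.
  exact: (derivable_under_integral mB It intf der G0 intG ub).
rewrite -derive1E (differentiation_under_integral mB It intf der G0 intG ub).
by apply: eq_Rintegral => x _; exact: d1.
Qed.

(** As [g' = - x g], the integrand is the derivative in [x] of [sin (t x + th) * g x]. The second
    integral is also the derivative of [F]. *)
Let stein t : t * F t + \int[mu]_(x in `[- a, a]) (- x * sin (t * x + th) * g x)
  = sin (t * a + th) * g a - sin (- (t * a) + th) * g a.
Proof.
have aa : - a < a by rewrite gtrN.
have i1 := integrable_cont (is_derive_cosg t).
have i2 := integrable_cont (is_derive_xsing t).
rewrite /F -RintegralZl// -RintegralD//; last first.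
  have := @integrableZl _ _ _ mu _ _ t _ i1; apply; exact: measurable_itv.
have cH : continuous (fun x => t * (cos (t * x + th) * g x) + - x * sin (t * x + th) * g x).
  move=> x; apply: cvgD.
    apply: cvgM; first exact: cvg_cst.
    exact: (continuous_derivable (is_derive_cosg t)).
  exact: (continuous_derivable (is_derive_xsing t)).
have gN : g (- a) = g a by rewrite /g sqrrN.
have cs : continuous (fun x => sin (t * x + th) * g x).
  exact: continuous_derivable (is_derive_sing t).
rewrite /Rintegral (@continuous_FTC2 _ _ (fun x => sin (t * x + th) * g x))//=.
- by rewrite mulrN gN.
- exact: continuous_subspaceT.
- split=> [x _||]; first by have [] := is_derive_sing t x.
    exact/cvg_at_right_filter/cs.
  exact/cvg_at_left_filter/cs.
- by move=> x _; rewrite derive1E; have [_ ->] := is_derive_sing t x; ring.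
Qed.

(** By [stein], [F' + t F] is a boundary term, so [exp (t^2 / 2) * F t] has a derivative of order
    [g a] and is nearly constant in [t]. *)
Lemma truncated_cos_bound t :
  `|expR (t ^+ 2 / 2) * F t - F 0| <= `|t| * (expR (t ^+ 2 / 2) * (2 * g a)).
Proof.
have D (s : R) : is_derive s 1 (fun s => expR (s ^+ 2 / 2) * F s)
    (expR (s ^+ 2 / 2) * (sin (s * a + th) * g a - sin (- (s * a) + th) * g a)).
  have D1 : is_derive s 1 (fun s : R => expR (s ^+ 2 / 2)) (s * expR (s ^+ 2 / 2)).
    by apply: is_derive_eq; rewrite /GRing.scale/=; field.
  apply: is_derive_eq (is_deriveM D1 (is_derive_F s)) _.
  by rewrite -stein /GRing.scale/=; ring.
have [c ct] := MVT0 t D.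
rewrite expr0n/= mul0r expR0 mul1r => ->; rewrite normrM mulrC ler_wpM2l//.
rewrite normrM ger0_norm ?expR_ge0// ler_pM ?expR_ge0//.
  rewrite ler_expR ler_pM2r// -(@real_normK _ c) ?num_real//.
  by rewrite -(@real_normK _ t) ?num_real// lerXn2r ?nnegrE.
apply: le_trans (ler_normB _ _) _; rewrite !(normrM _ (g a)) (ger0_norm (g_ge0 a)).
have h y : `|sin y| * g a <= g a.
  by rewrite ler_piMl// ler_norml sin_geN1 sin_le1.
by have := h (- (c * a) + th); have := h (c * a + th); lra.
Qed.

End truncated.

Let bmfun_cos_affine (t th : R) : bmfun ((fun x => cos (t * x + th)) : measurableTypeR R -> R).
Proof.
split; last by exists 1 => x; rewrite ler_norml cos_geN1 cos_le1.
apply: measurableT_comp; first by apply: continuous_measurable_fun; exact: continuous_cos.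
by apply: measurable_funD => //; exact: measurable_funM.
Qed.

Let Ex_truncation (f : R -> R) (a : R) : bmfun (f : measurableTypeR R -> R) ->
  (forall x, `|f x| <= 1) ->
  `|Ex Q f - \int[mu]_(x in `[- a, a]) (f x * g x)| <= fine (Q [set x : R | a < `|x|]).
Proof.
move=> bf f1.
have mU : measurable (`[- a, a]%classic : set (measurableTypeR R)) by exact: measurable_itv.
have mC : measurable ([set x : R | a < `|x|] : set (measurableTypeR R)).
  rewrite (_ : [set x : R | a < `|x|] = ~` `[- a, a]%classic); first exact: (measurableC mU).
  by apply/seteqP; split=> x /=; rewrite in_itv/= -ler_norml ltNge => /negP.
have -> : \int[mu]_(x in `[- a, a]) (f x * g x) = Ex Q (f \_ `[- a, a]).
  rewrite ExE -Rintegral_mkcond /Rintegral; congr fine.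
  by rewrite (integral_normal01 mU bf).
have bfU : bmfun ((f \_ `[- a, a]) : measurableTypeR R -> R).
  have [mf [B fB]] := bf; split; first exact: ((measurable_restrictT f mU).1 (measurable_funTS mf)).
  exists B => x; rewrite patchE; case: ifP => // _.
  by rewrite normr0; exact: le_trans (fB x).
rewrite -Ex_indic//; apply: Ex_dist_le => //; first exact: bmfun_indic.
move=> x; rewrite patchE indicE; case: ifPn => [_|]; first by rewrite subrr normr0.
rewrite notin_setE/= in_itv/= -ler_norml => /negP; rewrite -ltNge => ax.
by rewrite mem_set// subr0.
Qed.

Let normal01_tail (eps : R) : 0 < eps -> exists2 a : R, 0 < a &
  fine (Q [set x : R | a < `|x|]) <= eps /\ g a <= eps.
Proof.
move=> e0.
pose X (x : measurableTypeR R) : 'cV[R]_1 := \col_(i < 1) x.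
have mX i : measurable_fun setT (fun w => X w i ord0).
  by under eq_fun do rewrite mxE; exact: measurable_id.
have outE a : outside a X = [set x : R | a < `|x|].
  apply/seteqP; split=> x /= => [[i]|ax]; first by rewrite mxE.
  by exists ord0; rewrite mxE.
have [L L0 HL] := tight1 Q mX e0.
(* The first argument controls the tail probability, the second makes [g a] small through [exp (-
   a^2 / 2) <= 1 / (1 + a^2 / 2) <= 2 / a]. *)
pose a := Num.max L (1 + 2 * normal_peak 1 / eps).
have p0 : 0 <= 2 * normal_peak 1 / eps by rewrite divr_ge0 ?mulr_ge0// ltW.
have a1 : 1 + 2 * normal_peak 1 / eps <= a by rewrite le_max lexx orbT.
have a_gt0 : 0 < a by lra.
exists a => //; split.
  apply: le_trans HL; rewrite -outE fine_le ?fin_num_measure//; try exact: measurable_outside.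
  apply: le_measure; rewrite ?inE; try exact: measurable_outside.
  by move=> x [i ai]; exists i; apply: le_lt_trans ai; rewrite le_max lexx.
have h : expR (- a ^+ 2 / 2) <= 2 / a.
  rewrite mulNr expRN; apply: le_trans (_ : (1 + a ^+ 2 / 2)^-1 <= _).
    rewrite lef_pV2 ?posrE ?expR_gt0 ?expR_ge1Dx//.
    by rewrite ltr_wpDr// divr_ge0 ?sqr_ge0.
  rewrite -(invf_div a 2) lef_pV2 ?posrE ?divr_gt0//; last first.
    by rewrite ltr_wpDr// divr_ge0 ?sqr_ge0.
  by nra.
apply: le_trans (ler_wpM2l peak0 h) _.
rewrite mulrA ler_pdivrMr//.
have : 2 * normal_peak 1 / eps <= a by lra.
by rewrite ler_pdivrMr//; lra.
Qed.

Lemma Ex_cos_normal01 (t th : R) :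
  Ex Q (fun x => cos (t * x + th)) = expR (- t ^+ 2 / 2) * cos th.
Proof.
set E := Ex Q _; pose c := expR (t ^+ 2 / 2).
have c0 : 0 < c by exact: expR_gt0.
suff H : c * E = cos th.
  by rewrite -H mulrA -expRD mulNr addNr expR0 mul1r.
(* The three terms pay for the truncation at [t], multiplied by [c], for the boundary terms, and for
   the truncation at parameter 0, where the exact value is [cos th]. *)
pose C := c + `|t| * (c * 2) + 1.
have C0 : 0 < C.
  have : 0 <= `|t| * (c * 2) by rewrite !mulr_ge0// ltW.
  by rewrite /C; lra.
apply/eqP; rewrite -subr_eq0 -normr_le0; apply/ler_addgt0Pr => e e0; rewrite add0r.
have [a a0 [Qa ga]] := normal01_tail (divr_gt0 e0 C0).
set eps := e / C in Qa ga.
have cos1 x : `|cos x| <= 1 :> R by rewrite ler_norml cos_geN1 cos_le1.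
have h1 := le_trans (Ex_truncation a (bmfun_cos_affine t th) (fun x => cos1 _)) Qa.
have h0 := le_trans (Ex_truncation a (bmfun_cos_affine 0 th) (fun x => cos1 _)) Qa.
have h2 := truncated_cos_bound th a0 t.
have E0 : Ex Q (fun x => cos (0 * x + th)) = cos th.
  by under eq_fun do rewrite mul0r add0r; rewrite Ex_cst.
rewrite E0 -/E in h0 h1.
move: h0 h1 h2; set F0 := Rintegral _ _ _; set Ft := Rintegral _ _ _ => h0 h1 h2.
have eE : e = eps * C by rewrite /eps divfK// gt_eqF.
rewrite eE (_ : c * E - cos th = c * (E - Ft) + (c * Ft - F0) - (cos th - F0)); last by ring.
apply: le_trans (ler_normB _ _) _.
rewrite /C [leRHS]mulrDr mulr1; apply: lerD => //.
apply: le_trans (ler_normD _ _) _; rewrite [leRHS]mulrDr; apply: lerD.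
  by rewrite normrM (gtr0_norm c0) mulrC ler_wpM2r// ltW.
apply: le_trans h2 _; rewrite -/c [leRHS](_ : _ = `|t| * (c * (2 * eps))); last by ring.
by rewrite ler_wpM2l// ler_wpM2l ?(ltW c0)// ler_wpM2l.
Qed.

End standard_normal.

Section gaussian_vectors.
Variable R : realType.

Lemma Ex_prod (d1 d2 : measure_display) (T1 : measurableType d1) (T2 : measurableType d2)
    (P1 : probability T1 R) (P2 : probability T2 R) (f : T1 * T2 -> R) :
  bmfun f -> Ex (P1 \x P2)%E f = Ex P1 (fun x => Ex P2 (fun y => f (x, y))).
Proof.
move=> bf; have [mf [B fB]] := bf.
have bfx x : bmfun (fun y => f (x, y)).
  split; last by exists B => y; exact: fB.
  by apply: measurableT_comp => //; exact: measurable_pair1.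
rewrite /Ex; congr fine; rewrite !unlock.
rewrite -(integral12_prod_meas1 (f := EFin \o f)); last exact: (bmfun_integrable (P1 \x P2)%E bf).
apply: eq_integral => x _; rewrite /fubini_F /=.
by have := EFin_Ex P2 (bfx x); rewrite /Ex unlock.
Qed.

(** Each dimension adds an independent normal factor. For fixed values of the other coordinates
    their contribution is part of the phase of the new one, so the induction needs an arbitrary
    [th]. *)
Lemma std_gaussian_vector (k : nat) : exists (d : measure_display) (T : measurableType d)
    (Q : probability T R) (Z : T -> 'cV[R]_k),
  (forall i, measurable_fun setT (fun w => Z w i ord0)) /\
  forall (t : 'cV[R]_k) (th : R), Ex Q (fun w => cos ((t^T *m Z w) ord0 ord0 + th))
    = expR (- ((t^T *m t) ord0 ord0) / 2) * cos th.
Proof.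
elim: k => [|k [d [T [Q [Z [mZ HZ]]]]]].
  exists _, _, (normal_prob (0 : R) 1 : probability (measurableTypeR R) R), (fun=> 0); split.
    by case.
  move=> t th; under eq_fun do rewrite mxE big_ord0 add0r.
  by rewrite Ex_cst mxE big_ord0 oppr0 mul0r expR0 mul1r.
pose N : probability (measurableTypeR R) R := normal_prob (0 : R) 1.
pose Z' (w : T * measurableTypeR R) : 'cV[R]_k.+1 :=
  \col_i (if unlift ord0 i is Some j then Z w.1 j ord0 else w.2).
have mZ' i : measurable_fun setT (fun w => Z' w i ord0).
  under eq_fun do rewrite mxE.
  case: unliftP => [j _|_]; last exact: measurable_snd.
  by apply: (measurableT_comp (mZ j)); exact: measurable_fst.
exists _, _, (Q \x N)%E, Z'; split => // t th.
pose t' : 'cV[R]_k := \col_i t (lift ord0 i) ord0.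
have dot w x : (t^T *m Z' (w, x)) ord0 ord0 = t ord0 ord0 * x + (t'^T *m Z w) ord0 ord0.
  rewrite !mxE big_ord_recl; congr (_ + _); first by rewrite !mxE unlift_none.
  by apply: eq_bigr => i _; rewrite !mxE liftK.
rewrite Ex_prod; last exact: (bmfun_cos_dot mZ').
transitivity (Ex Q (fun w => expR (- t ord0 ord0 ^+ 2 / 2) * cos ((t'^T *m Z w) ord0 ord0 + th))).
  congr Ex; apply/funext => w; rewrite -Ex_cos_normal01.
  by congr Ex; apply/funext => x; rewrite dot addrA.
rewrite ExZ; last exact: bmfun_cos_dot.
rewrite HZ mulrA -expRD; congr (expR _ * _).
rewrite [in RHS]mxE big_ord_recl -mulrDl -opprD !mxE -expr2; congr (- (_ + _) / _).
by apply: eq_bigr => i _; rewrite !mxE.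
Qed.

Lemma gaussian_vector (M k : nat) (B : 'M[R]_(M, k)) :
  exists (d : measure_display) (T : measurableType d)
    (Q : probability T R) (Z : T -> 'cV[R]_M),
  is_normal0 Q (B *m B^T) Z /\
  forall (t : 'cV[R]_M) (th : R), Ex Q (fun w => cos ((t^T *m Z w) ord0 ord0 + th))
    = expR (- ((t^T *m (B *m B^T) *m t) ord0 ord0) / 2) * cos th.
Proof.
have [d [T [Q [Z [mZ HZ]]]]] := std_gaussian_vector k.
exists d, T, Q, (fun w => B *m Z w).
have mBZ i : measurable_fun setT (fun w => (B *m Z w) i ord0).
  under eq_fun do rewrite mxE.
  by apply: measurable_sum => j; apply: measurable_funM.
have H (t : 'cV[R]_M) th : Ex Q (fun w => cos ((t^T *m (B *m Z w)) ord0 ord0 + th))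
    = expR (- ((t^T *m (B *m B^T) *m t) ord0 ord0) / 2) * cos th.
  have := HZ (B^T *m t) th; rewrite trmx_mul trmxK !mulmxA => <-.
  by congr Ex; apply/funext => w; rewrite mulmxA.
split => //; split => // t; split.
  under eq_fun do rewrite -[X in cos X]addr0.
  by rewrite EFin_Ex ?H ?cos0 ?mulr1//; exact: (bmfun_cos_dot mBZ).
have -> : (fun w => sin ((t^T *m (B *m Z w)) ord0 ord0))
    = (fun w => cos ((t^T *m (B *m Z w)) ord0 ord0 + - (pi / 2))).
  by apply/funext => w; rewrite -[RHS]cosN opprD opprK cosDpihalf sinN opprK.
rewrite EFin_Ex; last exact: (bmfun_cos_dot mBZ).
by rewrite H cosN cos_pihalf mulr0.
Qed.

End gaussian_vectors.

(** * Linearization of the minimum divergence estimator *)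

Section admissible_functions.
Variables (R : realType) (phi : R -> R).
Hypothesis adm : admissible phi.
Let c : R := derive1 (derive1 phi) 1.

Let c_gt0 : 0 < c. Proof. by case: adm => _ _ _ _ []. Qed.
Let phi1 : phi 1 = 0. Proof. by case: adm => _ _ _ _ []. Qed.
Let dphi1 : derive1 phi 1 = 0. Proof. by case: adm => _ _ _ _ []. Qed.

Lemma admissible_is_derive (x : R) : 0 < x -> is_derive x 1 phi (derive1 phi x).
Proof.
by move=> x0; case: adm => _ /(_ x x0) dx _ _ _; rewrite derive1E; exact/derivableP.
Qed.

(** The first bound is differentiability of [phi'] at 1, where [phi'] vanishes; the second follows
    by the mean value theorem for [phi] minus its quadratic part. The cap 1/2 on [r] keeps [u]
    positive. *)
Lemma admissible_taylor (eta : R) : 0 < eta -> exists r : R, [/\ 0 < r, r <= 2^-1 &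
  forall u, `|u - 1| <= r -> `|derive1 phi u - c * (u - 1)| <= eta * `|u - 1| /\
    `|phi u - c * (u - 1) ^+ 2 / 2| <= eta * (u - 1) ^+ 2].
Proof.
move=> eta0.
have : derivable (derive1 phi) 1 1 by case: adm => _ _ /(_ 1 ltr01).
rewrite /derivable => /cvgrPdist_le/(_ _ eta0).
rewrite -/(derive (derive1 phi) 1 1) -derive1E -/c => /nbhs_ballP[r0 /= r00 Hr0].
have der u : `|u - 1| < r0 -> `|derive1 phi u - c * (u - 1)| <= eta * `|u - 1|.
  move=> ur; have [->|u1] := eqVneq u 1.
    by rewrite subrr normr0 mulr0 dphi1 mulr0 subrr normr0.
  have h0 : u - 1 != 0 by rewrite subr_eq0.
  have := Hr0 (u - 1); rewrite /ball/= sub0r normrN => /(_ ur h0).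
  rewrite dphi1 subr0 /GRing.scale/= mulr1 subrK => H.
  rewrite (_ : _ - _ = - ((c - (u - 1)^-1 * derive1 phi u) * (u - 1))); last by field.
  by rewrite normrN normrM ler_wpM2r.
pose r := Num.min (r0 / 2) 2^-1.
have r_gt0 : 0 < r by rewrite lt_min divr_gt0//= invr_gt0.
have rr0 : r < r0.
  by apply: le_lt_trans (_ : r0 / 2 < _); [rewrite ge_min lexx|lra].
have r2 : r <= 2^-1 by rewrite ge_min lexx orbT.
exists r; split => // u ur; split; first by apply: der; exact: le_lt_trans rr0.
pose h (x : R) := phi x - c * (x - 1) ^+ 2 / 2.
pose dh (x : R) := derive1 phi x - c * (x - 1).
have D (x : R) : 0 < x -> is_derive x 1 h (dh x).
  move=> x0; have D1 : is_derive x 1 (fun x : R => c * (x - 1) ^+ 2 / 2) (c * (x - 1)).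
    by apply: is_derive_eq; rewrite /GRing.scale/=; field.
  exact: is_deriveB (admissible_is_derive x0) D1.
have ctn (a b : R) : 0 < a -> {within `[a, b], continuous h}.
  move=> a0; apply: derivable_within_continuous => x; rewrite in_itv/= => /andP[ax _].
  by have [] := D x (lt_le_trans a0 ax).
have fin (x : R) : `|x - 1| <= `|u - 1| ->
    `|(derive1 phi x - c * (x - 1)) * (u - 1)| <= eta * (u - 1) ^+ 2.
  move=> xu; rewrite normrM -(@real_normK _ (u - 1)) ?num_real// expr2 mulrA ler_wpM2r//.
  apply: le_trans (der x _) _; last by rewrite ler_wpM2l// ltW.
  by apply: le_lt_trans xu (le_lt_trans ur rr0).
move: (ur); rewrite ler_norml => /andP[ul ul2].
have [u1|u1] := leP 1 u.
  have D' (x : R) : x \in `]1, u[ -> is_derive x 1 h (dh x).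
    by rewrite in_itv/= => /andP[x1 _]; apply: D; lra.
  have [x xu] := MVT_segment u1 D' (ctn 1 u ltr01).
  rewrite /h phi1 subrr expr0n/= mulr0 mul0r !subr0 => ->; apply: fin.
  by move: xu; rewrite in_itv/= => /andP[x1 x2]; rewrite !ger0_norm; lra.
have u0 : 0 < u by lra.
have D' (x : R) : x \in `]u, 1[ -> is_derive x 1 h (dh x).
  by rewrite in_itv/= => /andP[x1 _]; apply: D; lra.
have [x xu E] := MVT_segment (ltW u1) D' (ctn u 1 u0).
have : h u - h 1 = dh x * (u - 1) by rewrite -opprB E; ring.
rewrite /h phi1 subrr expr0n/= mulr0 mul0r !subr0 => ->; apply: fin.
by move: xu; rewrite in_itv/= => /andP[x1 x2]; rewrite !ler0_norm; lra.
Qed.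

(** The function [phi u - u * phi' u] is the derivative of [y |-> y phi (x / y)] at [u = x / y],
    hence the weight in the first-order condition; its linear part at 1 is [- c (u - 1)]. *)
Lemma admissible_psi (eta : R) : 0 < eta -> exists2 r : R, 0 < r &
  forall u, `|u - 1| <= r -> `|phi u - u * derive1 phi u + c * (u - 1)| <= eta * `|u - 1|.
Proof.
move=> eta0.
have e20 : 0 < eta / 2 by rewrite divr_gt0.
have [r1 [r10 _ H]] := admissible_taylor e20.
pose K := 2 * (2 * c + eta).
have K0 : 0 < K by rewrite /K; have := c_gt0; lra.
exists (Num.min r1 (eta / K)); first by rewrite lt_min r10 divr_gt0.
move=> u; rewrite le_min => /andP[ur1 urK]; have [h1 h2] := H u ur1.
have hx : K * `|u - 1| <= eta by rewrite mulrC -ler_pdivlMr.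
rewrite (_ : _ + _ = phi u - (u - 1) * derive1 phi u - (derive1 phi u - c * (u - 1))); last by ring.
apply: le_trans (ler_normB _ _) _; apply: le_trans (lerD (ler_normB _ _) h1) _.
rewrite normrM.
have g1 : `|derive1 phi u| <= (c + eta / 2) * `|u - 1|.
  have := le_trans (ler_normD (derive1 phi u - c * (u - 1)) (c * (u - 1))) (lerD h1 (lexx _)).
  by rewrite subrK normrM (gtr0_norm c_gt0); lra.
have g2 : `|phi u| <= (c / 2 + eta / 2) * `|u - 1| ^+ 2.
  have := le_trans (ler_normD (phi u - c * (u - 1) ^+ 2 / 2) (c * (u - 1) ^+ 2 / 2))
    (lerD h2 (lexx _)).
  rewrite subrK (ger0_norm (_ : 0 <= c * (u - 1) ^+ 2 / 2)); last first.
    by rewrite divr_ge0// mulr_ge0 ?sqr_ge0// ltW.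
  by rewrite real_normK ?num_real//; lra.
have g3 := ler_wpM2l (normr_ge0 (u - 1)) g1.
have g4 := ler_wpM2r (normr_ge0 (u - 1)) hx.
have g5 : 0 <= c * `|u - 1| ^+ 2 by rewrite mulr_ge0 ?sqr_ge0// ltW.
by move: g2 g3 g4 g5; rewrite /K; lra.
Qed.

Lemma admissible_upper : exists2 r : R, 0 < r &
  forall u, `|u - 1| <= r -> phi u <= c * (u - 1) ^+ 2.
Proof.
have c2 : 0 < c / 2 by rewrite divr_gt0.
have [r [r0 _ H]] := admissible_taylor c2.
exists r => // u ur; have [_] := H u ur.
by rewrite ler_norml => /andP[_]; lra.
Qed.

(** Within [r] of 1 the Taylor bound applies. Beyond, convexity on the segment from 1 to [u] gives
    linear growth, which is enough because [|q - p| <= 1] makes the square smaller than the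
    distance. *)
Lemma admissible_lower : exists2 k : R, 0 < k &
  forall p q, 0 < p <= 1 -> 0 < q <= 1 -> k * (q - p) ^+ 2 <= p * phi (q / p).
Proof.
have c4 : 0 < c / 4 by rewrite divr_gt0.
have [r [r0 r2 H]] := admissible_taylor c4.
have near1 u : `|u - 1| <= r -> c / 4 * (u - 1) ^+ 2 <= phi u.
  by move=> ur; have [_] := H u ur; rewrite ler_norml => /andP[+ _]; lra.
have far u : 0 < u -> r < `|u - 1| -> c / 4 * r * `|u - 1| <= phi u.
  move=> u0 ur; have n0 : 0 < `|u - 1| by apply: lt_trans ur.
  pose t := r / `|u - 1|.
  have t01 : 0 <= t <= 1.
    by rewrite divr_ge0 ?(ltW r0)//= ler_pdivrMr// mul1r ltW.
  case: adm => /(_ u 1 t u0 ltr01 t01) + _ _ _ _.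
  rewrite phi1 mulr0 addr0 mulr1 => cvx.
  have tE : `|t * u + (1 - t) - 1| = r.
    rewrite (_ : _ - 1 = t * (u - 1)); last by ring.
    by rewrite normrM ger0_norm ?divfK ?gt_eqF//; case/andP: t01.
  have := near1 (t * u + (1 - t)); rewrite tE lexx => /(_ isT).
  rewrite -(@real_normK _ (_ - 1)) ?num_real// tE => h.
  have := ler_wpM2r (ltW n0) (le_trans h cvx).
  rewrite [leRHS](_ : _ = r * phi u) => [h'|]; last first.
    by rewrite mulrAC /t divfK// gt_eqF.
  rewrite -(ler_pM2l r0); apply: le_trans h'.
  by rewrite le_eqVlt; apply/orP; left; apply/eqP; ring.
exists (c / 4 * r) => [|p q /andP[p0 p1] /andP[q0 q1]]; first by rewrite mulr_gt0.
have u0 : 0 < q / p by rewrite divr_gt0.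
have qp : q - p = p * (q / p - 1) by rewrite mulrBr mulr1 mulrC divfK// gt_eqF.
have [/near1 h|/(far _ u0) h] := leP `|q / p - 1| r.
  apply: le_trans (ler_wpM2l (ltW p0) h); rewrite qp.
  have s0 : 0 <= (q / p - 1) ^+ 2 by exact: sqr_ge0.
  have rp : 0 <= 1 - r * p by nra.
  rewrite -subr_ge0 (_ : _ - _ = p * (c / 4) * ((1 - r * p) * (q / p - 1) ^+ 2)); last by ring.
  by apply: mulr_ge0; apply: mulr_ge0 => //; exact: ltW.
apply: le_trans (ler_wpM2l (ltW p0) h).
rewrite [leRHS]mulrCA ler_wpM2l//; first by apply: mulr_ge0; exact: ltW.
rewrite -[X in _ <= X * _](gtr0_norm p0) -normrM -qp -real_normK ?num_real//.
rewrite expr2 ler_piMl// ler_norml; apply/andP; split; lra.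
Qed.

End admissible_functions.

Section one_norm.
Variable R : realType.

Definition norm1 k (x : 'cV[R]_k) : R := \sum_i `|x i ord0|.

Lemma norm1_ge0 k (x : 'cV[R]_k) : 0 <= norm1 x. Proof. exact: sumr_ge0. Qed.

Lemma norm1_coord k (x : 'cV[R]_k) i : `|x i ord0| <= norm1 x.
Proof. by rewrite /norm1 (bigD1 i)//= lerDl sumr_ge0. Qed.

Lemma norm1D k (x y : 'cV[R]_k) : norm1 (x + y) <= norm1 x + norm1 y.
Proof. by rewrite /norm1 -big_split/=; apply: ler_sum => i _; rewrite mxE ler_normD. Qed.

Lemma norm1N k (x : 'cV[R]_k) : norm1 (- x) = norm1 x.
Proof. by apply: eq_bigr => i _; rewrite mxE normrN. Qed.

Lemma norm1B k (x y : 'cV[R]_k) : norm1 (x - y) <= norm1 x + norm1 y.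
Proof. by apply: le_trans (norm1D _ _) _; rewrite norm1N. Qed.

Lemma norm1Z k (a : R) (x : 'cV[R]_k) : norm1 (a *: x) = `|a| * norm1 x.
Proof. by rewrite /norm1 mulr_sumr; apply: eq_bigr => i _; rewrite mxE normrM. Qed.

Definition mxsize k l (A : 'M[R]_(k, l)) : R := \sum_i \sum_j `|A i j|.

Lemma mxsize_ge0 k l (A : 'M[R]_(k, l)) : 0 <= mxsize A.
Proof. by apply: sumr_ge0 => i _; exact: sumr_ge0. Qed.

Lemma norm1_mulmx k l (A : 'M[R]_(k, l)) (x : 'cV[R]_l) : norm1 (A *m x) <= mxsize A * norm1 x.
Proof.
rewrite /norm1 /mxsize mulr_suml; apply: ler_sum => i _; rewrite mxE.
apply: le_trans (ler_norm_sum _ _ _) _; rewrite mulr_suml; apply: ler_sum => j _.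
by rewrite normrM ler_wpM2l//; exact: norm1_coord.
Qed.

Lemma dot_norm1 k (t x : 'cV[R]_k) : `|(t^T *m x) ord0 ord0| <= norm1 t * norm1 x.
Proof.
rewrite mxE; apply: le_trans (ler_norm_sum _ _ _) _.
rewrite /norm1 mulr_suml; apply: ler_sum => i _; rewrite mxE normrM ler_wpM2l//.
exact: norm1_coord.
Qed.

End one_norm.

(** * The log-linear model, its information matrix and the first-order condition *)

Section model.
Variables (R : realType) (M M0 : nat) (W : 'M[R]_(M, M0)).
Hypothesis M_gt0 : (0 < M)%N.
Implicit Types theta : 'cV[R]_M0.
Local Notation pr := (pmod W).

Lemma pmod_den_gt0 theta : 0 < \sum_(k < M) expR ((W *m theta) k ord0).
Proof.
by rewrite (bigD1 (Ordinal M_gt0))//= ltr_wpDr ?expR_gt0// sumr_ge0// => k _; exact: expR_ge0.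
Qed.

Lemma pmod_gt0 theta r : 0 < pr theta r ord0.
Proof. by rewrite mxE divr_gt0 ?expR_gt0// pmod_den_gt0. Qed.

Lemma pmod_sum1 theta : \sum_r pr theta r ord0 = 1.
Proof.
under eq_bigr do rewrite mxE.
by rewrite -mulr_suml divff// gt_eqF// pmod_den_gt0.
Qed.

Lemma pmod_le1 theta r : pr theta r ord0 <= 1.
Proof.
rewrite -(pmod_sum1 theta) (bigD1 r)//= lerDl sumr_ge0// => k _.
by rewrite ltW// pmod_gt0.
Qed.

Lemma ln_pmod theta r : ln (pr theta r ord0)
  = (W *m theta) r ord0 - ln (\sum_(k < M) expR ((W *m theta) k ord0)).
Proof. by rewrite mxE ln_div ?posrE ?expR_gt0 ?pmod_den_gt0// expRK. Qed.

Lemma Sigmap_mulE (p x : 'cV[R]_M) i :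
  (Sigmap p *m x) i ord0 = p i ord0 * (x i ord0 - \sum_k p k ord0 * x k ord0).
Proof.
rewrite /Sigmap mulmxBl mul_diag_mx -mulmxA !mxE big_ord1 !mxE mulrBr.
by congr (_ - _ * _); apply: eq_bigr => k _; rewrite mxE.
Qed.

(** The right-hand side is the variance of [y] under [p]: for positive [p] it vanishes only at
    constant vectors. *)
Lemma Sigmap_quad (p y : 'cV[R]_M) : \sum_r p r ord0 = 1 ->
  (y^T *m Sigmap p *m y) ord0 ord0
  = \sum_r p r ord0 * (y r ord0 - \sum_k p k ord0 * y k ord0) ^+ 2.
Proof.
move=> p1; rewrite -mulmxA mxE; set m := \sum_k p k ord0 * y k ord0.
under eq_bigr do rewrite Sigmap_mulE mxE -/m.
have E : \sum_r p r ord0 * (y r ord0 - m) = 0.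
  under eq_bigr do rewrite mulrBr.
  by rewrite sumrB -/m -mulr_suml p1 mul1r subrr.
transitivity (\sum_r y r ord0 * (p r ord0 * (y r ord0 - m))
    - m * \sum_r p r ord0 * (y r ord0 - m)); first by rewrite E mulr0 subr0.
by rewrite mulr_sumr -sumrB; apply: eq_bigr => r _; ring.
Qed.

Hypothesis rankW1 : \rank (row_mx W (const_mx 1 : 'cV[R]_M)) = M0.+1.

Lemma design_inj (v : 'cV[R]_M0) (c : R) : W *m v = const_mx c -> v = 0.
Proof.
move=> Wv.
have rf : row_free (row_mx W (const_mx 1 : 'cV[R]_M))^T.
  by rewrite /row_free mxrank_tr rankW1 addn1.
pose u := (col_mx v (const_mx (- c) : 'cV[R]_1))^T.
have : u *m (row_mx W (const_mx 1 : 'cV[R]_M))^T = 0 *m (row_mx W (const_mx 1 : 'cV[R]_M))^T.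
  rewrite mul0mx -trmx_mul mul_row_col Wv; apply/matrixP => i j.
  by rewrite !mxE big_ord1 !mxE mul1r subrr.
move/(row_free_inj rf) => /(congr1 trmx); rewrite trmxK trmx0 => /eqP.
by rewrite col_mx_eq0 => /andP[/eqP].
Qed.

(** A null vector [u] gives [W u] zero variance, so [W u] is constant, and independence from the
    all-ones vector forces [u = 0]. *)
Lemma fisher_unit theta : W^T *m Sigmap (pr theta) *m W \in unitmx.
Proof.
rewrite -row_free_unit -kermx_eq0; apply/rowV0P => u /sub_kermxP uA.
pose y := W *m u^T.
have Q0 : (y^T *m Sigmap (pr theta) *m y) ord0 ord0 = 0.
  rewrite /y trmx_mul trmxK.
  by rewrite !mulmxA -(mulmxA u) -(mulmxA u) uA mul0mx mxE.
rewrite Sigmap_quad ?pmod_sum1// in Q0.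
pose m := \sum_k pr theta k ord0 * y k ord0.
have ym r : y r ord0 = m.
  apply/eqP; rewrite -subr_eq0 -sqrf_eq0.
  have := psumr_eq0P _ Q0 => /(_ _ r isT) H.
  have /eqP := H (fun k _ => mulr_ge0 (ltW (pmod_gt0 theta k)) (sqr_ge0 _)).
  by rewrite mulf_eq0 gt_eqF ?pmod_gt0.
have : W *m u^T = const_mx m.
  by apply/colP => r; rewrite [RHS]mxE; exact: ym.
by move=> /design_inj /(congr1 trmx); rewrite trmxK trmx0.
Qed.

Section first_order_condition.
Variables (phi : R -> R).
Hypothesis adm : admissible phi.

Lemma dphi_fin (q : 'cV[R]_M) theta : (forall r, 0 < q r ord0) ->
  dphi phi q (pr theta)
  = (\sum_r pr theta r ord0 * phi (q r ord0 / pr theta r ord0))%:E.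
Proof.
move=> q0; rewrite /dphi -sumEFin; apply: eq_bigr => r _.
by rewrite /phi_term /phiE pmod_gt0 divr_gt0 ?pmod_gt0// EFinM.
Qed.

Lemma is_derive_sumf (n : nat) (F : 'I_n -> R -> R) (dF : 'I_n -> R) (s : R) :
  (forall i, is_derive s 1 (F i) (dF i)) ->
  is_derive s 1 (fun s => \sum_i F i s) (\sum_i dF i).
Proof.
move=> FD; rewrite (_ : (fun s => _) = \sum_i F i); first exact: is_derive_sum.
by apply/funext => x; rewrite fct_sumE.
Qed.

Lemma is_derive_pmod theta (v : 'cV[R]_M0) r (s : R) :
  is_derive s 1 (fun s => pr (theta + s *: v) r ord0)
    (pr (theta + s *: v) r ord0 * ((W *m v) r ord0
       - \sum_k pr (theta + s *: v) k ord0 * (W *m v) k ord0)).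
Proof.
pose E k (s : R) := expR ((W *m theta) k ord0 + s * (W *m v) k ord0).
have lin (t : R) k : (W *m (theta + t *: v)) k ord0 = (W *m theta) k ord0 + t * (W *m v) k ord0.
  by rewrite mulmxDr -scalemxAr !mxE.
pose S (s : R) := \sum_k E k s.
have prE k (t : R) : pr (theta + t *: v) k ord0 = E k t / S t.
  by rewrite mxE lin; congr (_ / _); apply: eq_bigr => j _; rewrite lin.
have ED k : is_derive s 1 (E k) (E k s * (W *m v) k ord0).
  by apply: is_derive_eq; rewrite /GRing.scale/= /E; ring.
have SD : is_derive s 1 S (\sum_k E k s * (W *m v) k ord0) by exact: is_derive_sumf.
have S0 : S s != 0.
  by rewrite gt_eqF// (_ : S s = \sum_k expR ((W *m (theta + s *: v)) k ord0)) ?pmod_den_gt0//;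
    apply: eq_bigr => k _; rewrite lin.
rewrite (_ : (fun s => _) = (fun t => E r t * (S t)^-1)); last by apply/funext => t; rewrite prE.
apply: is_derive_eq (is_deriveM (ED r) (is_deriveV S0 SD)) _.
rewrite /GRing.scale/= prE; under [in RHS]eq_bigr do rewrite prE mulrAC.
by rewrite -mulr_suml; field.
Qed.

(** Derivative of the divergence along the line [theta + s *: v] at its minimum [s = 0]. Positivity
    of [q] keeps the arguments of [phi] where it is differentiable, away from the conventions at
    0. *)
Lemma first_order_condition (q : 'cV[R]_M) theta (v : 'cV[R]_M0) :
  (forall r, 0 < q r ord0) ->
  (forall theta', (dphi phi q (pr theta) <= dphi phi q (pr theta'))%E) ->
  \sum_r (phi (q r ord0 / pr theta r ord0)
          - q r ord0 / pr theta r ord0 * derive1 phi (q r ord0 / pr theta r ord0))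
    * (pr theta r ord0 * ((W *m v) r ord0 - \sum_k pr theta k ord0 * (W *m v) k ord0)) = 0.
Proof.
move=> q0 Hmin.
pose P (r : 'I_M) (s : R) : R := pr (theta + s *: v) r ord0.
pose F (s : R) := \sum_r P r s * phi (q r ord0 * (P r s)^-1).
pose dP r (s : R) := P r s * ((W *m v) r ord0 - \sum_k P k s * (W *m v) k ord0).
pose psi u := phi u - u * derive1 phi u.
have Pgt0 r s : 0 < P r s by exact: pmod_gt0.
have PD r (s : R) : is_derive s 1 (P r) (dP r s) by exact: is_derive_pmod.
have FD (s : R) : is_derive s 1 F (\sum_r psi (q r ord0 / P r s) * dP r s).
  apply: is_derive_sumf => r.
  have u0 : 0 < q r ord0 / P r s by rewrite divr_gt0.
  have Pn0 : P r s != 0 by rewrite gt_eqF.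
  have D1 : is_derive s 1 (fun s => q r ord0 * (P r s)^-1) (q r ord0 * (- (P r s) ^- 2 * dP r s)).
    have := is_deriveV Pn0 (PD r s) => D0.
    have D2 := is_deriveM (is_derive_cst (q r ord0) s 1) D0.
    by apply: is_derive_eq D2 _; rewrite /GRing.scale/=; ring.
  have D3 := @is_derive1_comp R phi (fun s => q r ord0 * (P r s)^-1) s _ _
    (admissible_is_derive adm u0) D1.
  by apply: is_derive_eq (is_deriveM (PD r s) D3) _; rewrite /GRing.scale/= /psi; field.
have Fmin s : F 0 <= F s.
  by have := Hmin (theta + s *: v); rewrite !dphi_fin// lee_fin /F /P scale0r addr0.
have D0 : is_derive (0 : R) 1 F 0.
  apply: (@derive1_at_min R F (-1) 1 0) => [|t _||t _]; last exact: Fmin.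
  - by apply: le_trans ler01; rewrite oppr_le0.
  - by have [] := FD t.
  - by rewrite in_itv/= ltrN10 ltr01.
have [_ E0] := D0; have [_ E1] := FD 0.
by move: E1; rewrite E0 /dP /P /psi scale0r addr0 => <-.
Qed.

End first_order_condition.
End model.

Section linearization.
Variables (R : realType) (M M0 : nat) (W : 'M[R]_(M, M0)).
Hypothesis M_gt0 : (0 < M)%N.
Hypothesis rankW1 : \rank (row_mx W (const_mx 1 : 'cV[R]_M)) = M0.+1.
Variables (phi : R -> R) (theta0 : 'cV[R]_M0).
Hypothesis adm : admissible phi.
Implicit Types (theta : 'cV[R]_M0) (q : 'cV[R]_M).
Local Notation pr := (pmod W).
Let p0 := pr theta0.
Let S := Sigmap p0.
Let A := invmx (W^T *m S *m W).
Let H := S *m W *m A *m W^T.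

Let p0_gt0 r : 0 < p0 r ord0. Proof. exact: pmod_gt0. Qed.

Let pmin : exists2 m : R, 0 < m & forall r, m <= p0 r ord0.
Proof.
(* The entries are at most 1, so their product is below each of them. *)
exists (\prod_r p0 r ord0); first by apply: prodr_gt0 => r _.
move=> r; rewrite (bigD1 r)//= ler_piMr ?(ltW (p0_gt0 r))//.
suff H01 : 0 <= \prod_(k < M | k != r) p0 k ord0 <= 1 by case/andP: H01.
elim/big_ind : _ => [|x y /andP[x0 x1] /andP[y0 y1]|k _]; first by rewrite ler01 lexx.
  by rewrite mulr_ge0//= mulr_ile1.
by rewrite ltW//=; exact: pmod_le1.
Qed.

(** The inequality [ln (1 + x) <= x], applied also to [1 / (1 + x)], brackets the logarithm between
    [x / (1 + x)] and [x]. *)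
Lemma ln1D_bound (x : R) : `|x| <= 2^-1 -> `|ln (1 + x) - x| <= 2 * x ^+ 2.
Proof.
rewrite ler_norml => /andP[x1 x2].
have y0 : 0 < 1 + x by lra.
have h1 : ln (1 + x) <= x by apply: le_ln1Dx; lra.
have h2 : x / (1 + x) <= ln (1 + x).
  have := @le_ln1Dx R (- (x / (1 + x))).
  rewrite (_ : 1 + - (x / (1 + x)) = (1 + x)^-1); last by field; rewrite gt_eqF.
  rewrite lnV ?posrE// => h; rewrite -lerN2; apply: h.
  by rewrite ltrN2 ltr_pdivrMr// mul1r; lra.
rewrite ler0_norm ?subr_le0// opprB.
apply: le_trans (_ : x - x / (1 + x) <= _); first by lra.
rewrite (_ : x - _ = x ^+ 2 / (1 + x)); last by field; rewrite gt_eqF.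
rewrite ler_pdivrMr//; have : 0 <= x ^+ 2 by exact: sqr_ge0.
by move=> x20; nra.
Qed.

Let subE (x y : 'cV[R]_M) s : (x - y) s ord0 = x s ord0 - y s ord0.
Proof. by rewrite mxE [X in _ + X]mxE. Qed.

Lemma sum_diff0 q theta : \sum_r q r ord0 = 1 -> \sum_r (q - pr theta) r ord0 = 0.
Proof.
move=> q1; under eq_bigr do rewrite subE.
by rewrite sumrB q1 pmod_sum1// subrr.
Qed.

(* [log (pr theta) - log p0] equals [W (theta - theta0)] up to a constant
   vector, so [pr theta - p0] lies in the range of [S W] to second order. *)
Let tangent : exists C : R, exists2 del : R, 0 < del &
  0 <= C /\ forall theta, norm1 (pr theta - p0) <= del ->
  norm1 ((pr theta - p0) - H *m (pr theta - p0)) <= C * norm1 (pr theta - p0) ^+ 2.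
Proof.
have [m m0 pm] := pmin.
(* The radius [m / 2] keeps relative deviations below 1/2. In the constant, [2 / m] bounds the
   remainder [e] of the logarithm, the next 2 passes from [e] to [e'], and [1 + mxsize H] comes from
   applying [H - 1]. *)
exists ((1 + mxsize H) * (2 * (2 / m))), (m / 2); first by rewrite divr_gt0.
split.
  apply: mulr_ge0; first by rewrite addr_ge0 ?mxsize_ge0.
  by apply: mulr_ge0 => //; rewrite divr_ge0// ltW.
move=> theta; set D := pr theta - p0 => Dm.
pose eta := theta - theta0.
pose c := ln (\sum_(k < M) expR ((W *m theta) k ord0))
  - ln (\sum_(k < M) expR ((W *m theta0) k ord0)).
have lnE r : ln (pr theta r ord0) - ln (p0 r ord0) = (W *m eta) r ord0 - c.
  rewrite !ln_pmod// /eta mulmxBr [in RHS]mxE [X in _ = _ + X - _]mxE /c.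
  by ring.
pose e : 'cV[R]_M := \col_r (p0 r ord0 * ((W *m eta) r ord0 - c) - D r ord0).
have Dr r : `|D r ord0| <= m / 2 by apply: le_trans Dm; exact: norm1_coord.
have eB r : `|e r ord0| <= 2 / m * D r ord0 ^+ 2.
  rewrite mxE -lnE -ln_div ?posrE ?pmod_gt0//.
  pose x := D r ord0 / p0 r ord0.
  have pE : pr theta r ord0 / p0 r ord0 = 1 + x.
    rewrite /x (_ : D r ord0 = pr theta r ord0 - p0 r ord0).
      by field; rewrite gt_eqF.
    exact: subE.
  have xp : D r ord0 = p0 r ord0 * x by rewrite /x mulrC divfK// gt_eqF.
  have x2 : `|x| <= 2^-1.
    rewrite normrM normfV (gtr0_norm (p0_gt0 r)) ler_pdivrMr//.
    by apply: le_trans (Dr r) _; rewrite mulrC ler_pM2l ?invr_gt0.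
  rewrite pE [in leLHS]xp -mulrBr (normrM (p0 r ord0)) (gtr0_norm (p0_gt0 r)).
  apply: le_trans (ler_wpM2l (ltW (p0_gt0 r)) (ln1D_bound x2)) _.
  rewrite -(@real_normK _ x) ?num_real// -(@real_normK _ (D r ord0)) ?num_real//.
  rewrite [in leRHS]xp (normrM (p0 r ord0)) (gtr0_norm (p0_gt0 r)).
  rewrite (_ : 2 / m * _ = p0 r ord0 * (2 * `|x| ^+ 2) * (p0 r ord0 / m)); last first.
    by field; rewrite gt_eqF.
  by rewrite ler_peMr ?mulr_ge0 ?sqr_ge0 ?(ltW (p0_gt0 r))// ler_pdivlMr// mul1r.
have eN : norm1 e <= 2 / m * norm1 D ^+ 2.
  apply: le_trans (ler_sum _ (fun r _ => eB r)) _; rewrite -mulr_sumr.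
  rewrite ler_wpM2l ?divr_ge0 ?(ltW m0)// expr2 {1}/norm1 mulr_suml.
  apply: ler_sum => r _; rewrite -real_normK ?num_real// expr2 ler_wpM2l//.
  exact: norm1_coord.
have sD : \sum_r D r ord0 = 0 by apply: sum_diff0; exact: pmod_sum1.
pose mbar := \sum_k p0 k ord0 * (W *m eta) k ord0.
(* Summing over the cells determines the normalizing constant, since [D] sums to 0 and [p0] to 1. *)
have cE : c = mbar - \sum_r e r ord0.
  under eq_bigr do rewrite mxE mulrBr.
  rewrite !sumrB sD subr0 -/mbar -mulr_suml pmod_sum1// mul1r.
  by ring.
pose e' := e - (\sum_r e r ord0) *: p0.
have DE : D = S *m (W *m eta) - e'.
  apply/colP => r.
  rewrite [RHS]mxE [X in _ = _ + X]mxE (Sigmap_mulE p0 _ r) -/mbar.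
  rewrite /e' [X in _ - X]mxE [X in _ - (_ + X)]mxE [X in _ - (_ - X)]mxE.
  rewrite [e r _]mxE cE; ring.
(* [H] fixes the range of [S W], so the tangential part of [D] cancels. *)
have HD : D - H *m D = H *m e' - e'.
  rewrite {2}DE mulmxBr opprB addrCA; congr (_ + _).
  rewrite DE /H -!mulmxA (mulmxA W^T S) (mulmxA (W^T *m S)) (mulmxA A).
  by rewrite mulVmx ?fisher_unit// mul1mx addrAC subrr add0r.
have sE : `|\sum_r e r ord0| <= norm1 e by exact: ler_norm_sum.
have p01 : norm1 p0 = 1.
  by rewrite -(pmod_sum1 W M_gt0 theta0); apply: eq_bigr => r _; rewrite gtr0_norm.
have e'N : norm1 e' <= 2 * norm1 e.
  by apply: le_trans (norm1B _ _) _; rewrite norm1Z p01 mulr1; lra.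
rewrite HD; apply: le_trans (norm1B _ _) _.
apply: le_trans (lerD (norm1_mulmx _ _) (lexx _)) _.
rewrite (_ : _ * _ + _ = (1 + mxsize H) * norm1 e'); last by ring.
rewrite -!mulrA ler_wpM2l ?addr_ge0 ?mxsize_ge0//.
by apply: le_trans e'N _; rewrite ler_wpM2l// mulrA.
Qed.
Definition minimizer q theta :=
  forall theta', (dphi phi q (pr theta) <= dphi phi q (pr theta'))%E.

Let rate : exists C : R, exists2 del : R, 0 < del &
  0 <= C /\ forall q theta, \sum_r q r ord0 = 1 -> minimizer q theta ->
  norm1 (q - p0) <= del ->
  (forall r, 0 < q r ord0) /\ norm1 (q - pr theta) <= C * norm1 (q - p0).
Proof.
have [m m0 pm] := pmin.
have [r r0 up] := admissible_upper adm.
have [k k0 low] := admissible_lower adm.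
set c := derive1 (derive1 phi) 1 in up.
have c0 : 0 < c by case: adm => _ _ _ _ [].
pose K := c / m / k.
have K0 : 0 <= K by rewrite !divr_ge0// ltW.
(* [m / 2] keeps the entries of [q] positive; [m * r] keeps the ratios [q / p0] within [r] of 1,
   where the quadratic upper bound on [phi] holds. *)
exists (M%:R * Num.sqrt K), (Num.min (m / 2) (m * r)).
  by rewrite lt_min divr_gt0//= mulr_gt0.
split=> [|q theta q1 mini]; first by rewrite mulr_ge0.
rewrite le_min => /andP[qm qr].
have qB s : `|q s ord0 - p0 s ord0| <= norm1 (q - p0).
  by have := norm1_coord (q - p0) s; rewrite subE.
have q0 s : 0 < q s ord0.
  have := le_trans (qB s) qm; rewrite ler_norml => /andP[+ _].
  by have := pm s; move: m0; lra.
split=> //.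
have ql1 s : q s ord0 <= 1.
  by rewrite -q1 (bigD1 s)//= lerDl sumr_ge0// => j _; rewrite ltW.
have h1 : k * \sum_s (q s ord0 - pr theta s ord0) ^+ 2 <= c / m * norm1 (q - p0) ^+ 2.
  apply: le_trans (_ : \sum_s pr theta s ord0 * phi (q s ord0 / pr theta s ord0) <= _).
    rewrite mulr_sumr; apply: ler_sum => s _; apply: low.
      by rewrite pmod_gt0//= pmod_le1.
    by rewrite q0 ql1.
  have := mini theta0; rewrite !dphi_fin// lee_fin => /le_trans; apply.
  apply: le_trans (_ : \sum_s c / m * (q s ord0 - p0 s ord0) ^+ 2 <= _).
    apply: ler_sum => s _; set u := q s ord0 / _.
    have uE : u - 1 = (q s ord0 - p0 s ord0) / p0 s ord0.
      by rewrite /u mulrBl divff// gt_eqF.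
    have ur : `|u - 1| <= r.
      rewrite uE normrM normfV (gtr0_norm (p0_gt0 s)) ler_pdivrMr//.
      apply: le_trans (qB s) _; apply: le_trans qr _.
      by rewrite mulrC ler_pM2l.
    apply: le_trans (ler_wpM2l (ltW (p0_gt0 s)) (up u ur)) _.
    rewrite uE [leLHS](_ : _ = c / p0 s ord0 * (q s ord0 - p0 s ord0) ^+ 2); last first.
      by field; rewrite gt_eqF.
    by rewrite ler_wpM2r ?sqr_ge0// ler_pM2l// lef_pV2 ?posrE.
  rewrite -mulr_sumr ler_wpM2l ?divr_ge0 ?(ltW c0) ?(ltW m0)// expr2 {1}/norm1 mulr_suml.
  apply: ler_sum => s _; rewrite subE -real_normK ?num_real// expr2.
  by rewrite ler_wpM2l.
have h2 s : `|q s ord0 - pr theta s ord0| <= Num.sqrt K * norm1 (q - p0).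
  rewrite -(ler_pXn2r (isT : (0 < 2)%N)) ?nnegrE ?mulr_ge0 ?norm1_ge0//.
  rewrite exprMn sqr_sqrtr// real_normK ?num_real// -(ler_pM2l k0).
  rewrite (_ : k * (K * _) = c / m * norm1 (q - p0) ^+ 2); last first.
    by rewrite /K; field; rewrite !gt_eqF.
  apply: le_trans h1; rewrite ler_pM2l// (bigD1 s)//= lerDl sumr_ge0// => j _.
  exact: sqr_ge0.
apply: le_trans (_ : \sum_(s < M) Num.sqrt K * norm1 (q - p0) <= _).
  by apply: ler_sum => s _; have := h2 s; rewrite subE.
by rewrite sumr_const card_ord -[leLHS]mulr_natl mulrA.
Qed.

Let score (eta : R) : 0 < eta -> exists2 del : R, 0 < del &
  forall q theta, \sum_r q r ord0 = 1 -> minimizer q theta ->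
  norm1 (q - p0) <= del ->
  norm1 (W^T *m (q - pr theta)) <= eta * norm1 (q - p0).
Proof.
move=> eta0.
have [m m0 pm] := pmin.
have [C [del1 del10 [C0 Hrate]]] := rate.
set c := derive1 (derive1 phi) 1.
have c0 : 0 < c by case: adm => _ _ _ _ [].
pose Y := mxsize W.
have Y0 : 0 <= Y by exact: mxsize_ge0.
(* Number of coordinates, bound on a centred entry of [W], rate constant; the final 1 makes [L]
   positive. *)
pose L := M0%:R * (2 * Y) * C + 1.
have L0 : 0 < L by rewrite ltr_wpDl// !mulr_ge0.
pose eta' := eta * c / L.
have eta'0 : 0 < eta' by rewrite divr_gt0// mulr_gt0.
have [r r0 psiB] := admissible_psi adm eta'0.
rewrite -/c in psiB.
(* [|p - p0|] is at most [(C + 1) rho], so the radius keeps the entries of [p] above [m / 2] and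
   then the ratios [q / p] within [r] of 1. *)
pose K := 2 * (C + 1).
have K0 : 0 < K by rewrite mulr_gt0// ltr_wpDl.
exists (Num.min del1 (Num.min (m / K) (m * r / K))).
  by rewrite !lt_min del10 !divr_gt0// mulr_gt0.
move=> q theta q1 mini; rewrite !le_min => /and3P[d1 d2 d3].
have [q0 qpC] := Hrate q theta q1 mini d1.
set rho := norm1 (q - p0) in d1 d2 d3 qpC *.
have rho0 : 0 <= rho by exact: norm1_ge0.
have d2' : K * rho <= m by rewrite mulrC -ler_pdivlMr.
have d3' : K * rho <= m * r by rewrite mulrC -ler_pdivlMr.
set p := pr theta in qpC *.
have p_gt0 s : 0 < p s ord0 by exact: pmod_gt0.
have qpB s : `|q s ord0 - p s ord0| <= norm1 (q - p).
  by have := norm1_coord (q - p) s; rewrite subE.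
have qp0B s : `|q s ord0 - p0 s ord0| <= rho.
  by have := norm1_coord (q - p0) s; rewrite subE.
have p_m s : m / 2 <= p s ord0.
  have := le_trans (qpB s) qpC; have := qp0B s; have := pm s.
  rewrite !ler_norml => h /andP[h1 h2] /andP[h3 h4].
  by move: d2'; rewrite /K; lra.
have u_r s : `|q s ord0 / p s ord0 - 1| <= r.
  rewrite (_ : _ - 1 = (q s ord0 - p s ord0) / p s ord0); last by field; rewrite gt_eqF.
  rewrite normrM normfV (gtr0_norm (p_gt0 s)) ler_pdivrMr//.
  apply: le_trans (le_trans (qpB s) qpC) _.
  apply: le_trans (_ : r * (m / 2) <= _); last by rewrite ler_pM2l.
  by move: d3' rho0; rewrite /K; lra.
have coord j : `|(W^T *m (q - p)) j ord0| <= eta' / c * (2 * Y) * norm1 (q - p).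
  pose y (s : 'I_M) : R := W s j.
  have Wv s : (W *m (delta_mx j ord0 : 'cV[R]_M0)) s ord0 = y s by rewrite -colE mxE.
  pose ybar := \sum_k p k ord0 * y k.
  have ybE : \sum_k pr theta k ord0 * (W *m (delta_mx j ord0 : 'cV[R]_M0)) k ord0 = ybar.
    by apply: eq_bigr => k _; rewrite Wv.
  have foc : \sum_s (phi (q s ord0 / p s ord0)
      - q s ord0 / p s ord0 * derive1 phi (q s ord0 / p s ord0)) * (p s ord0 * (y s - ybar)) = 0.
    rewrite -[RHS](first_order_condition M_gt0 adm (delta_mx j ord0) q0 mini) ybE.
    by apply: eq_bigr => s _; rewrite Wv.
  have yY s : `|y s| <= Y.
    rewrite /Y /mxsize (bigD1 s)//= (bigD1 j)//= -addrA lerDl addr_ge0 ?sumr_ge0//.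
    by move=> i _; exact: sumr_ge0.
  have ybarY : `|ybar| <= Y.
    apply: le_trans (ler_norm_sum _ _ _) _.
    rewrite -[leRHS]mul1r -(pmod_sum1 W M_gt0 theta) mulr_suml; apply: ler_sum => s _.
    by rewrite normrM (gtr0_norm (p_gt0 s)) ler_pM2l.
  have lhsE : (W^T *m (q - p)) j ord0 = \sum_s (y s - ybar) * (q s ord0 - p s ord0).
    rewrite mxE; under [RHS]eq_bigr do rewrite mulrBl; rewrite sumrB -mulr_sumr.
    have := sum_diff0 theta q1; under eq_bigr do rewrite subE.
    move=> ->; rewrite mulr0 subr0; apply: eq_bigr => s _.
    by rewrite subE mxE.
  (* Centring the column of [W] is free because [q - p] sums to 0; adding the vanishing sum [foc]
     then replaces each linear term by the remainder bounded in [admissible_psi]. *)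
  have cE : c * (W^T *m (q - p)) j ord0
      = \sum_s (y s - ybar) * p s ord0 *
          (phi (q s ord0 / p s ord0) - q s ord0 / p s ord0 * derive1 phi (q s ord0 / p s ord0)
           + c * (q s ord0 / p s ord0 - 1)).
    rewrite lhsE; etransitivity; first exact/esym/addr0.
    rewrite -[X in _ + X]foc mulr_sumr -big_split/=; apply: eq_bigr => s _.
    by field; rewrite gt_eqF.
  have : c * `|(W^T *m (q - p)) j ord0| <= eta' * (2 * Y) * norm1 (q - p).
    rewrite -[X in X * _](gtr0_norm c0) -normrM cE.
    apply: le_trans (ler_norm_sum _ _ _) _; rewrite /norm1 mulr_sumr; apply: ler_sum => s _.
    rewrite subE !normrM (gtr0_norm (p_gt0 s)).
    have yy : `|y s - ybar| <= 2 * Y.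
      by apply: le_trans (ler_normB _ _) _; have := yY s; lra.
    apply: le_trans (_ : 2 * Y * p s ord0 * (eta' * `|q s ord0 / p s ord0 - 1|) <= _).
      apply: ler_pM => //; first by rewrite mulr_ge0// ltW.
        by rewrite ler_pM2r.
      exact: psiB.
    rewrite (_ : q s ord0 / p s ord0 - 1 = (q s ord0 - p s ord0) / p s ord0); last first.
      by field; rewrite gt_eqF.
    rewrite normrM normfV (gtr0_norm (p_gt0 s)) le_eqVlt; apply/orP; left; apply/eqP.
    by field; rewrite gt_eqF.
  rewrite mulrC -ler_pdivlMr// => /le_trans; apply.
  by rewrite le_eqVlt; apply/orP; left; apply/eqP; field; rewrite gt_eqF.
apply: le_trans (_ : \sum_(j < M0) eta' / c * (2 * Y) * norm1 (q - p) <= _).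
  by apply: ler_sum => j _; exact: coord.
rewrite sumr_const card_ord -[leLHS]mulr_natl.
apply: le_trans (_ : M0%:R * (eta' / c * (2 * Y) * (C * rho)) <= _).
  by rewrite ler_wpM2l// ler_wpM2l// !mulr_ge0// ?invr_ge0 ltW.
rewrite (_ : M0%:R * _ = eta * rho * ((M0%:R * (2 * Y) * C) / L)); last first.
  by rewrite /eta'; field; rewrite !gt_eqF.
rewrite ler_piMr ?mulr_ge0 ?(ltW eta0)// ler_pdivrMr// mul1r /L.
by rewrite lerDl.
Qed.

(** With [D = p - p0], the error equals [(D - H D) - H (q - p)]. The first part is quadratic by
    [tangent]; the second is small by [score], since [H] ends in the factor [W^T]. *)
Lemma minimizer_linearization (eps : R) : 0 < eps -> exists2 del : R, 0 < del &
  forall q theta, \sum_r q r ord0 = 1 -> minimizer q theta ->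
  norm1 (q - p0) <= del ->
  norm1 ((pr theta - p0) - H *m (q - p0)) <= eps * norm1 (q - p0).
Proof.
move=> eps0.
have [C1 [del1 del10 [C10 Hrate]]] := rate.
have [C2 [del2 del20 [C20 Htan]]] := tangent.
pose B := mxsize (S *m W *m A).
have B0 : 0 <= B by exact: mxsize_ge0.
pose eta := eps / (2 * (B + 1)).
have eta0 : 0 < eta by rewrite divr_gt0// mulr_gt0// ltr_wpDl.
have [del3 del30 Hscore] := score eta0.
pose K := C1 + 1.
have K0 : 0 < K by rewrite ltr_wpDl.
pose L := 2 * (C2 * K ^+ 2 + 1).
have L0 : 0 < L by rewrite mulr_gt0// ltr_wpDl// mulr_ge0// sqr_ge0.
exists (Num.min (Num.min del1 del3) (Num.min (del2 / K) (eps / L))).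
  by rewrite !lt_min del10 del30 !divr_gt0.
move=> q theta q1 mini; rewrite !le_min => /andP[/andP[d1 d3] /andP[d2 d4]].
have [q0 qpC] := Hrate q theta q1 mini d1.
have sc := Hscore q theta q1 mini d3.
set rho := norm1 (q - p0) in d1 d2 d3 d4 qpC sc *.
have rho0 : 0 <= rho by exact: norm1_ge0.
set D := pr theta - p0.
have DE : q - p0 = (q - pr theta) + D by rewrite /D addrA subrK.
have DK : norm1 D <= K * rho.
  rewrite (_ : D = (q - p0) - (q - pr theta)); last by rewrite DE addrAC subrr add0r.
  by apply: le_trans (norm1B _ _) _; rewrite -/rho /K; lra.
have Dd : norm1 D <= del2.
  by apply: le_trans DK _; rewrite mulrC -ler_pdivlMr.
have h1 := Htan theta Dd; rewrite -/D in h1.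
have h2 : norm1 (H *m (q - pr theta)) <= B * (eta * rho).
  rewrite /H -mulmxA; apply: le_trans (norm1_mulmx _ _) _.
  by rewrite -/B ler_wpM2l.
rewrite (_ : D - H *m (q - p0) = (D - H *m D) - H *m (q - pr theta)); last first.
  by rewrite DE mulmxDr opprD addrA addrAC.
apply: le_trans (norm1B _ _) _; apply: le_trans (lerD h1 h2) _.
have g1 : C2 * norm1 D ^+ 2 <= C2 * K ^+ 2 * rho * rho.
  rewrite [leRHS](_ : _ = C2 * (K * rho) ^+ 2); last by ring.
  by rewrite ler_wpM2l// lerXn2r ?nnegrE ?norm1_ge0// mulr_ge0// ltW.
have g2 : C2 * K ^+ 2 * rho <= eps / 2.
  have : L * rho <= eps by rewrite mulrC -ler_pdivlMr.
  by rewrite /L; lra.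
have g3 : B * eta <= eps / 2.
  rewrite /eta (_ : B * _ = eps / 2 * (B / (B + 1))); last first.
    by field; rewrite gt_eqF// ltr_wpDl.
  by rewrite ler_piMr ?divr_ge0 ?(ltW eps0)// ler_pdivrMr ?mul1r ?lerDl ?ltr_wpDl.
have := ler_wpM2r rho0 g2; have := ler_wpM2r rho0 g3.
by move: g1; lra.
Qed.

End linearization.

(** * Limit law of the residuals *)

Section covariance.
Variable R : realType.

(** With [s] the unit vector of square roots of [p] and [D = diag s], one has
    [Sigmap p = D (1 - s s^T) D]. The middle factor is an orthogonal projection, so
    [C = D (1 - s s^T)]. *)
Lemma Sigmap_factor M (p : 'cV[R]_M) : (forall r, 0 <= p r ord0) -> \sum_r p r ord0 = 1 ->
  exists C : 'M[R]_M, Sigmap p = C *m C^T.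
Proof.
move=> p_ge0 p1.
pose s : 'cV[R]_M := \col_r Num.sqrt (p r ord0).
pose D := diag_mx s^T.
have DT : D^T = D by exact: tr_diag_mx.
have ss : s^T *m s = 1%:M.
  apply/matrixP => i j; rewrite !ord1 !mxE eqxx -p1; apply: eq_bigr => r _.
  by rewrite !mxE -expr2 sqr_sqrtr.
have Ds : D *m s = p.
  apply/colP => r; rewrite mul_diag_mx !mxE -expr2 sqr_sqrtr//; exact: p_ge0.
have DD : D *m D = diag_mx p^T.
  by apply/matrixP => i j; rewrite mul_diag_mx !mxE mulrnAr -expr2 sqr_sqrtr//; exact: p_ge0.
exists (D - p *m s^T); rewrite linearB/= trmx_mul trmxK DT.
rewrite mulmxBl !mulmxBr DD (mulmxA D) Ds.
have sD : s^T *m D = p^T by rewrite -Ds trmx_mul DT.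
rewrite -(mulmxA p s^T D) sD.
by rewrite -(mulmxA p) (mulmxA s^T) ss mul1mx subrr subr0.
Qed.

Lemma tr_Sigmap M (p : 'cV[R]_M) : (Sigmap p)^T = Sigmap p.
Proof. by rewrite /Sigmap linearB/= tr_diag_mx trmx_mul trmxK. Qed.

(** [H] acts as the identity on the range of [H S], and [S H^T = H S]; of the four terms of the
    expansion two cancel. *)
Lemma projected_covariance M M0 (W : 'M[R]_(M, M0)) (S : 'M[R]_M) :
  S^T = S -> W^T *m S *m W \in unitmx ->
  let H := S *m W *m invmx (W^T *m S *m W) *m W^T in
  (1%:M - H) *m S *m (1%:M - H)^T
  = S - S *m W *m invmx (W^T *m S *m W) *m W^T *m S.
Proof.
move=> ST U H; rewrite -[X in _ = _ - X]/(H *m S).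
set A := invmx _ in H *.
have AT : A^T = A.
  by rewrite /A trmx_inv !trmx_mul trmxK ST mulmxA.
have HT : H^T = W *m A *m W^T *m S by rewrite /H !trmx_mul trmxK AT ST !mulmxA.
have SHT : S *m H^T = H *m S by rewrite HT /H !mulmxA.
have HH : H *m (H *m S) = H *m S.
  rewrite {1}/H -!mulmxA (mulmxA W^T S) (mulmxA (W^T *m S) W) (mulmxA A).
  by rewrite /A mulVmx// mul1mx.
rewrite linearB/= trmx1 mulmxBr mulmx1 mulmxBl mul1mx mulmxBl SHT -mulmxA SHT HH.
by rewrite subrr subr0.
Qed.

End covariance.

(** Cauchy-Schwarz against the all-ones vector, through [2 a b <= a^2 + b^2]. *)
Lemma sqr_norm1_le (R : realType) k (x : 'cV[R]_k) :
  norm1 x ^+ 2 <= k%:R * \sum_i x i ord0 ^+ 2.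
Proof.
rewrite expr2 {1}/norm1 mulr_suml.
apply: le_trans (_ : \sum_i \sum_j (x i ord0 ^+ 2 + x j ord0 ^+ 2) / 2 <= _).
  apply: ler_sum => i _; rewrite mulr_sumr; apply: ler_sum => j _.
  rewrite -(@real_normK _ (x i ord0)) ?num_real// -(@real_normK _ (x j ord0)) ?num_real//.
  by have := sqr_ge0 (`|x i ord0| - `|x j ord0|); rewrite sqrrB; lra.
set s := \sum_i x i ord0 ^+ 2.
rewrite (eq_bigr (fun i => k%:R * x i ord0 ^+ 2 / 2 + s / 2)); last first.
  move=> i _; rewrite -mulr_suml big_split/= sumr_const card_ord.
  by rewrite -[X in (X + _) / 2]mulr_natl mulrDl.
rewrite big_split/= sumr_const card_ord -[X in _ + X]mulr_natl -mulr_suml -mulr_sumr -/s.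
by lra.
Qed.

Lemma cos_lipschitz (R : realType) (x y : R) : `|cos x - cos y| <= `|x - y|.
Proof.
have D (z : R) : is_derive z 1 (fun z : R => cos (z + y)) (- sin (z + y)).
  by apply: is_derive_eq; rewrite /GRing.scale/=; ring.
have [c _] := MVT0 (x - y) D; rewrite subrK add0r => ->.
by rewrite normrM ler_piMl// normrN ler_norml sin_geN1 sin_le1.
Qed.

Section asymptotics.
Variables (R : realType) (M M0 : nat) (W : 'M[R]_(M, M0)).
Variables (n : nat) (rho2 : R) (theta0 : 'cV[R]_M0).
Variables (d : measure_display) (T : measurableType d) (P : probability T R).
Variables (Y : nat -> T -> 'cV[nat]_M) (phi : R -> R).
Variable thetahat : nat -> T -> 'cV[R]_M0.
Hypothesis M_gt0 : (0 < M)%N.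
Hypothesis rankW1 : \rank (row_mx W (const_mx 1 : 'cV[R]_M)) = M0.+1.
Hypothesis n_gt0 : (0 < n)%N.
Hypothesis Ysum : forall l w, (\sum_(r < M) Y l w r ord0)%N = n.
Hypothesis mY : forall l (r : 'I_M), measurable_fun setT (fun w => (Y l w r ord0)%:R : R).
Hypothesis iidY : iid_seq P Y.
Local Notation pr := (pmod W).
Let p0 := pr theta0.
Let S := Sigmap p0.
Let vn : R := design_effect n rho2 / n%:R.
Hypothesis EY : forall r : 'I_M,
  ('E_P[fun w => ((Y 0%N w r ord0)%:R)%R])%E = (n%:R * p0 r ord0)%:E.
Hypothesis VY : forall r s : 'I_M,
  ('E_P[fun w => (((Y 0%N w r ord0)%:R - n%:R * p0 r ord0) *
                  ((Y 0%N w s ord0)%:R - n%:R * p0 s ord0))%R])%E =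
  (design_effect n rho2 * n%:R * S r s)%:E.
Hypothesis adm : admissible phi.
Hypothesis mini : forall N w, (0 < N)%N -> minimizer W phi (phat R n Y N w) (thetahat N w).
Hypothesis mtheta : forall N i, measurable_fun setT (fun w => thetahat N w i ord0).
Local Notation q := (phat R n Y).
Let A := invmx (W^T *m S *m W).
Let H := S *m W *m A *m W^T.

Let nR : 0 < n%:R :> R. Proof. by rewrite ltr0n. Qed.

Let centered (y : 'cV[nat]_M) : 'cV[R]_M := \col_r ((y r ord0)%:R / n%:R - p0 r ord0).

Let functional (t : 'cV[R]_M) y : R := (t^T *m centered y) ord0 ord0.

Let bmf := @bmfun_cluster R M n d T Y Ysum mY.

Let qE N w : (0 < N)%N -> q N w - p0 = N%:R^-1 *: \sum_(l < N) centered (Y l w).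
Proof.
move=> N0; have NR : N%:R != 0 :> R by rewrite pnatr_eq0 -lt0n.
apply/colP => r; rewrite [RHS]mxE summxE.
transitivity ((\sum_(l < N) (Y l w r ord0)%:R) / (n * N)%:R - p0 r ord0).
  by rewrite mxE [X in _ + X]mxE [X in X - _]mxE.
under [in RHS]eq_bigr do rewrite mxE.
rewrite sumrB -mulr_suml sumr_const card_ord -[X in _ = _ * (_ - X)]mulr_natl.
by rewrite natrM; field; rewrite NR gt_eqF.
Qed.

Let functional_sum t N w : (0 < N)%N ->
  \sum_(l < N) functional t (Y l w) = N%:R * (t^T *m (q N w - p0)) ord0 ord0.
Proof.
move=> N0; have NR : N%:R != 0 :> R by rewrite pnatr_eq0 -lt0n.
rewrite qE// -scalemxAr [X in _ * X]mxE mulVKf// mulmx_sumr summxE.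
by apply: eq_bigr.
Qed.

Let Ex_Y r : Ex P (fun w => (Y 0%N w r ord0)%:R) = n%:R * p0 r ord0.
Proof. by rewrite /Ex EY. Qed.

Let Ex_functional t : Ex P (fun w => functional t (Y 0%N w)) = 0.
Proof.
rewrite /functional; under eq_fun do rewrite mxE.
have b r : bmfun (fun w => (Y 0%N w r ord0)%:R : R) := bmf (fun y => (y r ord0)%:R) 0%N.
rewrite (Ex_sum P _ (F := fun r w => t^T ord0 r * centered (Y 0%N w) r ord0)); last first.
  by move=> r; exact: (bmf (fun y => t^T ord0 r * centered y r ord0)).
apply: big1 => r _.
transitivity (t r ord0 * (n%:R^-1 * Ex P (fun w => (Y 0%N w r ord0)%:R) - p0 r ord0)).
  rewrite -(ExZ P _ (b r)) -[X in _ - X](Ex_cst P) -ExB; [|exact: bmfunZ|exact: bmfun_cst].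
  rewrite -ExZ; last by apply: bmfunB; [exact: bmfunZ|exact: bmfun_cst].
  by congr Ex; apply/funext => w; rewrite !mxE [n%:R^-1 * _]mulrC.
by rewrite Ex_Y mulKf ?gt_eqF// subrr mulr0.
Qed.

Let Ex_functional2 t : Ex P (fun w => functional t (Y 0%N w) ^+ 2)
  = vn * (t^T *m S *m t) ord0 ord0.
Proof.
pose z r (y : 'cV[nat]_M) : R := (y r ord0)%:R - n%:R * p0 r ord0.
have Ez r s : Ex P (fun w => z r (Y 0%N w) * z s (Y 0%N w)) = design_effect n rho2 * n%:R * S r s.
  by rewrite /Ex VY.
have cE y r : centered y r ord0 = z r y / n%:R.
  by rewrite mxE /z mulrBl [n%:R * _]mulrC mulfK ?gt_eqF.
have fE y : functional t y ^+ 2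
    = \sum_r \sum_s (t r ord0 * t s ord0 / n%:R ^+ 2) * (z r y * z s y).
  rewrite /functional mxE expr2 mulr_suml; apply: eq_bigr => r _.
  rewrite mulr_sumr; apply: eq_bigr => s _; rewrite !cE [t^T ord0 r]mxE [t^T ord0 s]mxE.
  by field; rewrite gt_eqF.
under eq_fun do rewrite fE.
rewrite Ex_sum; last first.
  move=> r.
  by apply: (bmf (fun y => \sum_s t r ord0 * t s ord0 / n%:R ^+ 2 * (z r y * z s y))).
under eq_bigr => r _.
  rewrite Ex_sum; last first.
    by move=> s; apply: (bmf (fun y => t r ord0 * t s ord0 / n%:R ^+ 2 * (z r y * z s y))).
  under eq_bigr => s _.
    rewrite (ExZ P _ (bmf (fun y => z r y * z s y) 0%N)) Ez.
    over.
  over.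
rewrite mxE mulr_sumr exchange_big/=; apply: eq_bigr => s _.
rewrite mxE mulr_suml mulr_sumr; apply: eq_bigr => r _.
by rewrite [t^T _ _]mxE /vn; field; rewrite gt_eqF.
Qed.

Let V0 : R := M%:R * \sum_(r < M) Ex P (fun w => functional (delta_mx r ord0) (Y 0%N w) ^+ 2).

(** Majorant of [N |q - p0|^2] in the sum norm, the factor [M] coming from Cauchy-Schwarz. Its mean
    is [V0] for every positive [N], so it serves in all Markov estimates below. *)
Let G N w : R := N%:R * (M%:R * \sum_(r < M) (q N w - p0) r ord0 ^+ 2).

Let bm_coord N r : (0 < N)%N -> bmfun (fun w => (q N w - p0) r ord0).
Proof.
move=> N0; under eq_fun do rewrite qE// mxE summxE.
by apply: bmfunZ; apply: bmfun_sum => l; exact: (bmf (fun y => centered y r ord0)).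
Qed.

Let bm_G N : (0 < N)%N -> bmfun (G N).
Proof.
move=> N0; apply: bmfunZ; apply: bmfunZ; apply: bmfun_sum => r.
by under eq_fun do rewrite expr2; apply: bmfunM; exact: bm_coord.
Qed.

Let Ex_G N : (0 < N)%N -> Ex P (G N) = V0.
Proof.
move=> N0; have NR : N%:R != 0 :> R by rewrite pnatr_eq0 -lt0n.
have bs r : bmfun (fun w => (q N w - p0) r ord0 ^+ 2).
  by under eq_fun do rewrite expr2; apply: bmfunM; exact: bm_coord.
have bS : bmfun (fun w => \sum_(r < M) (q N w - p0) r ord0 ^+ 2) by exact: bmfun_sum.
rewrite /G (ExZ P _ (bmfunZ M%:R bS)) (ExZ P _ bS) Ex_sum// mulrCA /V0; congr (_ * _).
rewrite mulr_sumr; apply: eq_bigr => r _.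
have E := @Ex_iid_sqr R M n d T P Y Ysum mY iidY (functional (delta_mx r ord0)) N
  (Ex_functional (delta_mx r ord0)).
transitivity (N%:R * (N%:R^-1 ^+ 2 *
    (N%:R * Ex P (fun w => functional (delta_mx r ord0) (Y 0%N w) ^+ 2)))); last by field.
congr (_ * _); rewrite -E -ExZ; last first.
  under eq_fun do rewrite expr2.
  by apply: bmfunM; apply: bmfun_sum => l; exact: (bmf (functional (delta_mx r ord0))).
congr Ex; apply/funext => w; rewrite functional_sum// trmx_delta -rowE [X in N%:R * X]mxE.
by field.
Qed.

Let V0_ge0 : 0 <= V0.
Proof.
rewrite -(Ex_G (isT : (0 < 1)%N)) -(Ex_cst P 0); apply: Ex_le; [exact: bmfun_cst|exact: bm_G|].
by move=> w; rewrite /G mulr_ge0// mulr_ge0// sumr_ge0// => r _; exact: sqr_ge0.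
Qed.

Let norm1_G N w : N%:R * norm1 (q N w - p0) ^+ 2 <= G N w.
Proof. by rewrite ler_wpM2l//; exact: sqr_norm1_le. Qed.

Let q_sum1 N w : (0 < N)%N -> \sum_r q N w r ord0 = 1.
Proof.
move=> N0; under eq_bigr do rewrite mxE.
rewrite -mulr_suml exchange_big/= (eq_bigr (fun=> n%:R)); last first.
  by move=> l _; rewrite -(Ysum l w) natr_sum.
rewrite sumr_const card_ord -[X in X / _]mulr_natr -natrM divff// pnatr_eq0 -lt0n.
by rewrite muln_gt0 n_gt0.
Qed.

Let X N w : 'cV[R]_M := Num.sqrt N%:R *: (q N w - pr (thetahat N w)).

Let mX N i : measurable_fun setT (fun w => X N w i ord0).
Proof.
under eq_fun do rewrite mxE mxE [X in _ + X]mxE [X in X - _]mxE.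
have mW k : measurable_fun setT (fun w => (W *m thetahat N w) k ord0).
  under eq_fun do rewrite mxE.
  by apply: measurable_sum => j; apply: measurable_funM => //; exact: mtheta.
apply: measurable_funM => //; apply: measurable_funB.
  apply: measurable_funM => //; apply: measurable_sum => l; exact: mY.
have E w : pr (thetahat N w) i ord0 = expR ((W *m thetahat N w) i ord0
    - ln (\sum_(k < M) expR ((W *m thetahat N w) k ord0))).
  by rewrite -ln_pmod// lnK// posrE pmod_gt0.
under eq_fun do rewrite E.
apply: measurableT_comp; first exact: measurable_expR.
apply: measurable_funB => //; apply: measurableT_comp; first exact: measurable_ln.
by apply: measurable_sum => k; apply: measurableT_comp => //; exact: measurable_expR.
Qed.

Let XE N w : X N w - (1%:M - H) *m (Num.sqrt N%:R *: (q N w - p0))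
  = - (Num.sqrt N%:R *: ((pr (thetahat N w) - p0) - H *m (q N w - p0))).
Proof.
rewrite /X -scalemxAr -scalerBr -scalerN; congr (_ *: _).
have sub4 (a b c h : 'cV[R]_M) : (a - b) - ((a - c) - h) = - ((b - c) - h).
  by apply/matrixP => i j; rewrite !mxE; ring.
by rewrite mulmxBl mul1mx sub4.
Qed.

(** From [x <= 1 + x^2]: linear error terms too are absorbed by the majorant of known mean. *)
Let sqrtN_norm1 N w : (0 < N)%N -> Num.sqrt N%:R * norm1 (q N w - p0) <= 1 + G N w.
Proof.
move=> N0; have := norm1_G N w.
have h : (Num.sqrt N%:R * norm1 (q N w - p0)) ^+ 2 = N%:R * norm1 (q N w - p0) ^+ 2.
  by rewrite exprMn sqr_sqrtr.
rewrite -h; have := sqr_ge0 (Num.sqrt N%:R * norm1 (q N w - p0) - 1).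
by rewrite sqrrB1; move: (Num.sqrt _ * _) => x; nra.
Qed.

(** One third of [e] goes to the central limit theorem along [t' = (1 - H)^T t], one to the
    linearization error where [|q - p0| <= del], and one to the complement, where the cosines differ
    by at most 2, which is below [c2 * G]. *)
Let cos_cvg (t : 'cV[R]_M) th : Ex P (fun w => cos ((t^T *m X N w) ord0 ord0 + th)) @[N --> \oo] -->
  expR (- (vn * (t^T *m ((1%:M - H) *m S *m (1%:M - H)^T) *m t) ord0 ord0) / 2) * cos th.
Proof.
pose t' := (1%:M - H)^T *m t.
have t'E : t'^T = t^T *m (1%:M - H) by rewrite trmx_mul trmxK.
have := @clt_cos R M n d T P Y Ysum mY iidY (functional t') th (Ex_functional t').
rewrite Ex_functional2 {2}/t' t'E !mulmxA => clt.
apply/cvgrPdist_le => e e0.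
pose D := norm1 t * (1 + V0) + 1.
have D0 : 0 < D by rewrite ltr_wpDl// mulr_ge0 ?norm1_ge0 ?addr_ge0.
pose eps := e / 3 / D.
have eps0 : 0 < eps by rewrite !divr_gt0.
have [del del0 Hlin] := minimizer_linearization M_gt0 rankW1 theta0 adm eps0.
have e30 : 0 < e / 3 by rewrite divr_gt0.
move/cvgrPdist_le: clt => /(_ _ e30) clt.
pose Zs (N : nat) w := \sum_(l < N) functional t' (Y l w) / Num.sqrt N%:R + th.
near=> N.
have N0 : (0 < N)%N by near: N; exact: nbhs_infty_gt.
have NR : 0 < N%:R :> R by rewrite ltr0n.
have HN : 2 * V0 / del ^+ 2 / (e / 3) <= N%:R by near: N; exact: nbhs_infty_ger.
have h1 : `|expR (- (vn * (t^T *m (1%:M - H) *m S *m (1%:M - H)^T *m t) ord0 ord0) / 2) * cos th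
    - Ex P (fun w => cos (Zs N w))| <= e / 3 by near: N; exact: clt.
set Z := Zs N in h1.
have sN : 0 < Num.sqrt N%:R :> R by rewrite sqrtr_gt0.
have ZE w : `|((t^T *m X N w) ord0 ord0 + th) - Z w|
    <= norm1 t * (Num.sqrt N%:R * norm1 ((pr (thetahat N w) - p0) - H *m (q N w - p0))).
  have -> : ((t^T *m X N w) ord0 ord0 + th) - Z w
      = (t^T *m (X N w - (1%:M - H) *m (Num.sqrt N%:R *: (q N w - p0)))) ord0 ord0.
    have dotB (u v : 'cV[R]_M) :
        (t^T *m (u - v)) ord0 ord0 = (t^T *m u) ord0 ord0 - (t^T *m v) ord0 ord0.
      by rewrite mulmxBr mxE [X in _ + X]mxE.
    have dotH : (t^T *m ((1%:M - H) *m (Num.sqrt N%:R *: (q N w - p0)))) ord0 ord0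
        = Num.sqrt N%:R * (t'^T *m (q N w - p0)) ord0 ord0.
      by rewrite -!scalemxAr mulmxA -t'E mxE.
    have NE : N%:R / Num.sqrt N%:R = Num.sqrt N%:R :> R.
      by rewrite -[in LHS](sqr_sqrtr (ltW NR)) sqrtr_sqr (gtr0_norm sN) expr2 mulfK// gt_eqF.
    rewrite dotB dotH /Z /Zs -mulr_suml functional_sum// mulrAC NE.
    by ring.
  rewrite XE; apply: le_trans (dot_norm1 _ _) _.
  by rewrite norm1N norm1Z gtr0_norm.
pose c1 := norm1 t * eps; pose c2 := 2 / (del ^+ 2 * N%:R).
have c10 : 0 <= c1 by rewrite mulr_ge0 ?norm1_ge0// ltW.
have d2 : 0 < del ^+ 2 * N%:R by rewrite mulr_gt0// exprn_gt0.
have c20 : 0 <= c2 by rewrite divr_ge0// ltW.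
have G0 w : 0 <= G N w.
  by apply: le_trans (norm1_G N w); rewrite mulr_ge0// sqr_ge0.
have bG := bm_G N0.
have bB : bmfun (fun w => (c1 + c1 * G N w) + c2 * G N w).
  by apply: bmfunD; [apply: bmfunD; [exact: bmfun_cst|exact: bmfunZ]|exact: bmfunZ].
have bZ : bmfun (fun w => cos (Z w)).
  split; last by exists 1 => w; rewrite ler_norml cos_geN1 cos_le1.
  apply: measurableT_comp; first by apply: continuous_measurable_fun; exact: continuous_cos.
  have [//] : bmfun Z.
  apply: bmfunD; last exact: bmfun_cst.
  apply: bmfun_sum => l; apply: bmfunM; last exact: bmfun_cst.
  exact: (bmf (functional t')).
have h2 : `|Ex P (fun w => cos ((t^T *m X N w) ord0 ord0 + th)) - Ex P (fun w => cos (Z w))|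
    <= (c1 + c1 * V0) + c2 * V0.
  apply: le_trans (Ex_dist_le P (bmfun_cos_dot (mX N) t th) bZ bB _) _.
    move=> w; have [small|big] := leP (norm1 (q N w - p0)) del.
      apply: le_trans (cos_lipschitz _ _) _; apply: le_trans (ZE w) _.
      apply: le_trans (_ : c1 + c1 * G N w <= _); last by rewrite lerDl mulr_ge0.
      rewrite [leRHS](_ : _ = norm1 t * (eps * (1 + G N w))); last by rewrite /c1; ring.
      rewrite ler_wpM2l ?norm1_ge0//.
      have := Hlin _ (thetahat N w) (q_sum1 w N0) (mini w N0) small => lin.
      apply: le_trans (ler_wpM2l (ltW sN) lin) _.
      by rewrite mulrCA ler_wpM2l ?(ltW eps0)// sqrtN_norm1.
    apply: le_trans (_ : c2 * G N w <= _); last by rewrite lerDr addr_ge0// mulr_ge0.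
    apply: le_trans (_ : 2 <= _).
      apply: le_trans (ler_normB _ _) _.
      have c_1 (x : R) : `|cos x| <= 1 by rewrite ler_norml cos_geN1 cos_le1.
      by have := lerD (c_1 ((t^T *m X N w) ord0 ord0 + th)) (c_1 (Z w)); lra.
    rewrite /c2 mulrAC ler_pdivlMr// ler_pM2l// mulrC; apply: le_trans (norm1_G N w).
    by rewrite ler_pM2l// lerXn2r ?nnegrE ?norm1_ge0// ltW.
  rewrite (ExD P (bmfunD (bmfun_cst T c1) (bmfunZ c1 bG)) (bmfunZ c2 bG)).
  by rewrite (ExD P (bmfun_cst T c1) (bmfunZ c1 bG)) Ex_cst !(ExZ P _ bG) Ex_G.
have h3 : c1 + c1 * V0 <= e / 3.
  rewrite (_ : c1 + _ = e / 3 * (norm1 t * (1 + V0) / D)); last first.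
    by rewrite /c1 /eps; field; rewrite gt_eqF.
  by rewrite ler_piMr ?(ltW e30)// ler_pdivrMr// mul1r /D lerDl.
have h4 : c2 * V0 <= e / 3.
  rewrite /c2 mulrAC ler_pdivrMr//; move: HN; rewrite ler_pdivrMr// ler_pdivrMr ?exprn_gt0//.
  by move=> /le_trans; apply; rewrite le_eqVlt; apply/orP; left; apply/eqP; ring.
move: h1 h2; rewrite !ler_norml => /andP[? ?] /andP[? ?].
by apply/andP; split; lra.
Unshelve. all: by end_near. Qed.

(** Linearization with error factor 1 bounds [X N] by [K sqrt N |q - p0|]. Leaving the box thus
    forces [G >= L^2 / K^2], or [G >= del^2 N] if [q] is farther than [del] from [p0]; Markov's
    inequality gives each case [eps / 2]. *)
Let X_tight eps : 0 < eps ->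
  exists L, \forall N \near \oo, fine (P (outside L (X N))) <= eps.
Proof.
move=> eps0.
have [del del0 Hlin] := minimizer_linearization M_gt0 rankW1 theta0 adm ltr01.
pose K := 2 + mxsize H.
have K0 : 0 < K by rewrite ltr_wpDr ?mxsize_ge0.
(* The summand 1 ensures [L <= L^2], so that [L^2] inherits the lower bound [K^2 V0 / (eps / 2)]. *)
pose L := 1 + K ^+ 2 * V0 / (eps / 2).
have e20 : 0 < eps / 2 by rewrite divr_gt0.
have L1 : 1 <= L by rewrite lerDl divr_ge0 ?(ltW e20)// mulr_ge0 ?sqr_ge0.
have L0 : 0 < L by exact: lt_le_trans L1.
exists L; near=> N.
have N0 : (0 < N)%N by near: N; exact: nbhs_infty_gt.
have NR : 0 < N%:R :> R by rewrite ltr0n.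
have HN : V0 / del ^+ 2 / (eps / 2) <= N%:R by near: N; exact: nbhs_infty_ger.
have sN : 0 < Num.sqrt N%:R :> R by rewrite sqrtr_gt0.
have G0 w : 0 <= G N w.
  by apply: le_trans (norm1_G N w); rewrite mulr_ge0// sqr_ge0.
pose c1 := K ^+ 2 / L ^+ 2; pose c2 := (del ^+ 2 * N%:R)^-1.
have d2 : 0 < del ^+ 2 * N%:R by rewrite mulr_gt0// exprn_gt0.
have c10 : 0 <= c1 by rewrite divr_ge0 ?sqr_ge0.
have c20 : 0 <= c2 by rewrite invr_ge0 ltW.
have mo : measurable (outside L (X N)) by exact: (measurable_outside (mX N)).
have bG := bm_G N0.
rewrite -Ex_indic//.
apply: le_trans (_ : Ex P (fun w => c1 * G N w + c2 * G N w) <= _).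
  apply: Ex_le; [exact: bmfun_indic|by apply: bmfunD; exact: bmfunZ|].
  move=> w; rewrite indicE; have [/set_mem [i Li]|_] := boolP (w \in _); last first.
    by rewrite addr_ge0// mulr_ge0.
  have [small|big] := leP (norm1 (q N w - p0)) del.
    apply: le_trans (_ : c1 * G N w <= _); last by rewrite lerDl mulr_ge0.
    have lin := Hlin _ (thetahat N w) (q_sum1 w N0) (mini w N0) small.
    have XB : norm1 (X N w) <= K * (Num.sqrt N%:R * norm1 (q N w - p0)).
      rewrite norm1Z (gtr0_norm sN) mulrCA ler_pM2l//.
      rewrite (_ : _ - _ = (q N w - p0) - H *m (q N w - p0)
        - ((pr (thetahat N w) - p0) - H *m (q N w - p0))); last first.
        have sub4 (a b c h : 'cV[R]_M) : a - b = (a - c) - h - ((b - c) - h).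
          by apply/matrixP => ? ?; rewrite !mxE; ring.
        exact: sub4.
      apply: le_trans (norm1B _ _) _; apply: le_trans (lerD (norm1B _ _) lin) _.
      by have := norm1_mulmx H (q N w - p0); rewrite /K; lra.
    have h : L <= K * (Num.sqrt N%:R * norm1 (q N w - p0)).
      by apply: le_trans XB; apply: le_trans (ltW Li) _; exact: norm1_coord.
    rewrite /c1 mulrAC ler_pdivlMr ?exprn_gt0// mul1r.
    apply: le_trans (_ : (K * (Num.sqrt N%:R * norm1 (q N w - p0))) ^+ 2 <= _).
      by rewrite lerXn2r ?nnegrE ?(ltW L0)// !mulr_ge0 ?norm1_ge0 ?(ltW K0).
    rewrite !exprMn sqr_sqrtr ?(ltW NR)// ler_pM2l ?exprn_gt0//; exact: norm1_G.
  apply: le_trans (_ : c2 * G N w <= _); last by rewrite lerDr mulr_ge0.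
  rewrite /c2 mulrC ler_pdivlMr// mul1r mulrC; apply: le_trans (norm1_G N w).
  by rewrite ler_pM2l// lerXn2r ?nnegrE ?norm1_ge0// ltW.
rewrite (ExD P (bmfunZ c1 bG) (bmfunZ c2 bG)) !(ExZ P _ bG) Ex_G// [leRHS]splitr.
apply: lerD.
  rewrite /c1 mulrAC ler_pdivrMr ?exprn_gt0// [leRHS]mulrC -ler_pdivrMr//.
  apply: le_trans (_ : L <= _); first by rewrite /L lerDr.
  by rewrite expr2 ler_peMr// ltW.
rewrite /c2 mulrC ler_pdivrMr//; move: HN; rewrite ler_pdivrMr// ler_pdivrMr ?exprn_gt0//.
by move=> /le_trans; apply; rewrite le_eqVlt; apply/orP; left; apply/eqP; ring.
Unshelve. all: by end_near. Qed.

Hypothesis rho2_ge0 : 0 <= rho2.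

Lemma residual_cvg_law : cvg_law_normal0 P X
  (vn *: (S - S *m W *m A *m W^T *m S)).
Proof.
have U : W^T *m S *m W \in unitmx by exact: fisher_unit.
have cov := projected_covariance (tr_Sigmap p0) U; rewrite -/S -/A -/H in cov.
have vn0 : 0 <= vn by rewrite divr_ge0// addr_ge0// mulr_ge0.
have [C SC] := Sigmap_factor (fun r => ltW (pmod_gt0 W M_gt0 theta0 r)) (pmod_sum1 W M_gt0 theta0).
(* A nonnegative design effect has a real square root, so the scaled limit covariance has the form
   [B B^T] required of a linear image of standard normals. *)
pose B := Num.sqrt vn *: ((1%:M - H) *m C).
have BE : B *m B^T = vn *: (S - S *m W *m A *m W^T *m S).
  rewrite /B linearZ/= -scalemxAl -scalemxAr scalerA -expr2 sqr_sqrtr//.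
  by rewrite trmx_mul -cov /S SC !mulmxA.
have [d' [T' [Q [Z [nZ HZ]]]]] := gaussian_vector B.
rewrite BE in nZ HZ; exists d', T', Q, Z; split=> //.
apply: levy_continuity => //; first by case: nZ.
move=> t th; rewrite HZ -scalemxAr -scalemxAl -cov [X in - X / 2]mxE.
exact: cos_cvg.
Qed.

End asymptotics.

Theorem theorem1 (R : realType) (M M0 : nat) (W : 'M[R]_(M, M0))
  (n : nat) (rho2 : R) (theta0 : 'cV[R]_M0)
  (d : measure_display) (T : measurableType d) (P : probability T R)
  (Y : nat -> T -> 'cV[nat]_M) (phi : R -> R)
  (thetahat : nat -> T -> 'cV[R]_M0) :
  (3 <= M)%N -> (1 <= M0)%N -> (M0 < M.-1)%N ->
  \rank W = M0 ->
  \rank (row_mx W (const_mx 1 : 'cV[R]_M)) = M0.+1 ->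
  (2 <= n)%N -> 0 <= rho2 ->
  (* cluster frequency vectors: nonnegative integer entries summing to n *)
  (forall l w, (\sum_(r < M) Y l w r ord0)%N = n) ->
  (forall l (r : 'I_M), measurable_fun setT (fun w => (Y l w r ord0)%:R : R)) ->
  iid_seq P Y ->
  (* E[Y^(l)] = n p(theta0) *)
  (forall l (r : 'I_M),
     ('E_P[fun w => ((Y l w r ord0)%:R)%R])%E = (n%:R * pmod W theta0 r ord0)%:E) ->
  (* Var[Y^(l)] = design_effect * n * Sigma_{p(theta0)} *)
  (forall l (r s : 'I_M),
     ('E_P[fun w => (((Y l w r ord0)%:R - n%:R * pmod W theta0 r ord0) *
                   ((Y l w s ord0)%:R - n%:R * pmod W theta0 s ord0))%R])%E =
     (design_effect n rho2 * n%:R * Sigmap (pmod W theta0) r s)%:E) ->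
  admissible phi ->
  (* thetahat N is the QMphiE based on the first N clusters (a measurable minimizer) *)
  (forall N w (theta : 'cV[R]_M0), (0 < N)%N ->
     (dphi phi (phat R n Y N w) (pmod W (thetahat N w))
      <= dphi phi (phat R n Y N w) (pmod W theta))%E) ->
  (forall N (i : 'I_M0), measurable_fun setT (fun w => thetahat N w i 0)) ->
  let S := Sigmap (pmod W theta0) in
  cvg_law_normal0 P
    (fun N w => Num.sqrt (N%:R) *: (phat R n Y N w - pmod W (thetahat N w)))
    ((design_effect n rho2 / n%:R) *:
       (S - S *m W *m invmx (W^T *m S *m W) *m W^T *m S)).
Proof.
move=> M3 _ _ _ rankW1 n2 rho20 Ysum mY iidY EY VY adm mini mth S.
by apply: residual_cvg_law (EY 0%N) (VY 0%N) adm _ mth rho20 => //;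
  [exact: ltn_trans M3|exact: ltn_trans n2|move=> N w N0 theta; exact: mini].
Qed.
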